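(* Fix $\epsilon\leq 10^{-3}$ and an integer $k\geq 100$. Let $A$ be a linear tripartite $3$-uniform hypergraph with $n$ vertices in each class that contains at least $\epsilon n^5$ octahedra. Then there exists a sequence $A=A_0\supset A_1\supset A_2\supset\cdots$ of subhypergraphs such that for each $i\geq 1$, $A_i$ has at least $\alpha_i n^2$ faces, $A_i$ contains at least $\epsilon_i n^5$ octahedra, and for each $r=2,\dots,k$ every $2r$-cycle in $A_i$ (of any label class) has at least $\gamma_i n^{2r}$ different $\theta_i$-popular ring decompositions in $A_{i-1}$, where $\alpha_i,\epsilon_i,\theta_i,\gamma_i$ depend only on $\epsilon,k,i$ and each is at least $\epsilon^{k^{15i}}$.
   Context: The hypergraph has vertex classes $V_1,V_2,V_3$ with $|V_j|=n$; its faces are triples $(v_1,v_2,v_3)\in V_1\times V_2\times V_3$, and it is linear if any two vertices lie in at most one common face. Subhypergraphs are subsets of the faces. An octahedron is an $8$-tuple of faces $(t_\omega)_{\omega\in\{0,1\}^3}$, $t_\omega=(a_\omega,b_\omega,c_\omega)$, such that $a_\omega$ depends only on $(\omega_2,\omega_3)$, $b_\omega$ only on $(\omega_1,\omega_3)$ and $c_\omega$ only on $(\omega_1,\omega_2)$ (degeneracies allowed); octahedra are counted as such tuples. For $c\in\{1,2,3\}$ with $\{s,t\}=\{1,2,3\}\setminus\{c\}$, a $2r$-cycle with label class $c$ and pattern $(s,t)$ is a sequence of faces $(f_1,\dots,f_{2r})$ such that $f_i,f_{i+1}$ share their class-$s$ vertex for $i$ odd and their class-$t$ vertex for $i$ even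 (indices mod $2r$); its label sequence is the sequence of class-$c$ vertices. Such a cycle is $\theta$-popular in a hypergraph $A'$ if its label sequence is the label sequence of at least $\theta n$ cycles in $A'$ with the same label class and pattern. A ring decomposition in $A'$ of such a cycle $(f_1,\dots,f_{2r})$ is a $2r$-cycle $(g_1,\dots,g_{2r})$ in $A'$ with label class $c$ and pattern $(t,s)$ such that for each $i$ there are faces $h_i,h_i'$ of $A'$ with $h_i$ having the class-$s$ vertex of $g_i$ and the class-$t$ vertex of $f_i$, and $h_i'$ having the class-$s$ vertex of $f_i$ and the class-$t$ vertex of $g_i$ (so that $(f_i,h_i',g_i,h_i)$ is a $4$-cycle with label class $c$, the rectangle with opposite corners $f_i,g_i$); it is $\theta$-popular if $(g_1,\dots,g_{2r})$ and all $2r$ of these rectangles are $\theta$-popular in $A'$. Ring decompositions are counted as distinct sequences $(g_1,\dots,g_{2r})$. *)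

(* Defs.v *)
From HB Require Import structures.
From mathcomp Require Import all_boot all_order all_algebra.
From mathcomp Require Import reals.

Set Implicit Arguments.
Unset Strict Implicit.
Unset Printing Implicit Defensive.

Import Order.TTheory GRing.Theory Num.Theory.
Local Open Scope ring_scope.

(* The vertex classes are V 0, V 1, V 2; the class-j vertex of a face f is f j. *)
Definition face (V : 'I_3 -> finType) := {dffun forall j : 'I_3, V j}.

Definition linear_hypergraph (V : 'I_3 -> finType) (A : {set face V}) : Prop :=
  forall (i j : 'I_3) (u : V i) (w : V j), i != j ->
    (#|[set f : face V in A | (f i == u) && (f j == w)]| <= 1)%N.

Definition is_octahedron (V : 'I_3 -> finType)
    (t : {ffun {ffun 'I_3 -> bool} -> face V}) : bool :=
  [forall j : 'I_3, forall w : {ffun 'I_3 -> bool},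
     forall w' : {ffun 'I_3 -> bool},
       [forall (l : 'I_3 | l != j), w l == w' l] ==> (t w j == t w' j)].

Definition octahedra (V : 'I_3 -> finType) (A : {set face V}) :
    {set {ffun {ffun 'I_3 -> bool} -> face V}} :=
  [set t : {ffun {ffun 'I_3 -> bool} -> face V} |
     [forall w, t w \in A] && is_octahedron t].

Definition face_seq (V : 'I_3 -> finType) (r : nat) :=
  {ffun 'I_(2 * r) -> face V}.

(* Indices start at 0 here, so the odd positions of the 1-based convention
   (sharing the class-s vertex) are the even values of i; ordS is cyclic. *)
Definition is_cycle (V : 'I_3 -> finType) (s t : 'I_3) (r : nat)
    (f : face_seq V r) : bool :=
  [forall i : 'I_(2 * r),
     if odd i then f i t == f (ordS i) t else f i s == f (ordS i) s].

(* The 2r-cycles of A with pattern (s, t); the label class is the third one. *)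
Definition cycles (V : 'I_3 -> finType) (A : {set face V}) (s t : 'I_3)
    (r : nat) : {set face_seq V r} :=
  [set f : face_seq V r | [forall i, f i \in A] && is_cycle s t f].

Definition labels (V : 'I_3 -> finType) (c : 'I_3) (r : nat)
    (f : face_seq V r) : {ffun 'I_(2 * r) -> V c} :=
  [ffun i => f i c].

Definition popular (R : realType) (V : 'I_3 -> finType) (n : nat) (theta : R)
    (A : {set face V}) (c s t : 'I_3) (r : nat) (f : face_seq V r) : bool :=
  theta * n%:R <=
    #|[set g in cycles A s t r | labels c g == labels c f]|%:R.

(* When h, h' are as in popular_ring_decompositions below, this is a 4-cycle
   with pattern (s, t). *)
Definition rectangle (V : 'I_3 -> finType) (f h' g h : face V) : face_seq V 2 :=
  [ffun i : 'I_(2 * 2) => nth f [:: f; h'; g; h] i].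

(* In a linear hypergraph the faces h, h' are determined by f i and g i. *)
Definition popular_ring_decompositions (R : realType) (V : 'I_3 -> finType)
    (n : nat) (theta : R) (A : {set face V}) (c s t : 'I_3) (r : nat)
    (f : face_seq V r) : {set face_seq V r} :=
  [set g in cycles A t s r |
     popular n theta A c t s g &&
     [forall i : 'I_(2 * r), exists h in A, exists h' in A,
        [&& h s == g i s, h t == f i t, h' s == f i s, h' t == g i t
          & popular n theta A c s t (rectangle (f i) h' (g i) h)]]].

(* Main.v *)
(** Fix a label class c and view the faces as the edges, labelled by the class-c
    vertices, of a bipartite graph on the other two classes s and t. An octahedron
    is a pair of 4-cycles with the same labels.

    - Fix two faces e, e' with the same label and keep the faces f that are
      opposite to e in a 4-cycle having a copy with the same labels at e'. On
      average over the at most n^3 pairs (e, e'), at least eps n^2 faces are kept,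
      whereas a given cycle with few copies survives for few pairs, as (e, e') is
      determined by e and the translated copy. Hence some choice gives a dense
      graph G almost all of whose cycles of every length 2r <= 2k are popular.
    - Dependent random choice in G: for a suitable p, almost all triples of
      neighbours of p have many common neighbours. Keeping only well behaved
      vertices leaves a dense subgraph such that each of its 2r-cycles is the base
      of many prisms C_2r x K_2 in G. Such prisms are the ring decompositions.
    - After deleting the edges lying in many unpopular rectangles, most of the
      prisms on a remaining cycle are made of popular cycles.
    - The remaining graph A' is dense, so it has many 4-cycles, mostly popular in
      A. There are at most n^3 / theta popular label sequences, so by
      Cauchy-Schwarz A' still has many octahedra.

    Each label class turns eps into at worst eps^(k^5); the three classes are
    treated one after the other, and the resulting step is iterated. *)

Require Import Defs.
From HB Require Import structures.
From mathcomp Require Import all_boot all_order all_algebra.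
From mathcomp Require Import boolp reals.
From mathcomp Require Import zify ring lra.

Set Implicit Arguments.
Unset Strict Implicit.
Unset Printing Implicit Defensive.

Import Order.TTheory GRing.Theory Num.Theory.
Local Open Scope ring_scope.

(** * Counting finite sets by injections and fibres *)

Section Counting.

Lemma card_le_inj (X Y : finType) (A : {set X}) (B : {set Y}) (f : X -> Y) :
    {in A, forall x, f x \in B} -> {in A &, injective f} ->
  (#|A| <= #|B|)%N.
Proof.
move=> fAB f_inj; rewrite -(card_in_imset f_inj); apply: subset_leq_card.
by apply/subsetP => _ /imsetP[x xA ->]; apply: fAB.
Qed.

Lemma card_set_sum (X : finType) (P : pred X) :
  (#|[set x | P x]| = \sum_x P x)%N.
Proof. by rewrite -sum1_card big_mkcond; apply: eq_bigr => x _; rewrite inE; case: (P x). Qed.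

Lemma card_set_pair (X Y : finType) (P : X -> Y -> bool) :
  (#|[set z : X * Y | P z.1 z.2]| = \sum_x #|[set y | P x y]|)%N.
Proof.
rewrite card_set_sum -(pair_bigA _ (fun x y => P x y : nat)) /=.
by apply: eq_bigr => x _; rewrite card_set_sum.
Qed.

Lemma card_set_dep (X Y : finType) (B : {set X}) (F : X -> {set Y}) :
  (#|[set z : X * Y | (z.1 \in B) && (z.2 \in F z.1)]| = \sum_(x in B) #|F x|)%N.
Proof.
rewrite (card_set_pair (fun x y => (x \in B) && (y \in F x))) [RHS]big_mkcond.
apply: eq_bigr => x _; case: (x \in B) => /=.
  by apply: eq_card => y; rewrite inE.
by apply/eqP; rewrite cards_eq0; apply/eqP/setP => y; rewrite !inE.
Qed.

Lemma sum_fibers (X Y : finType) (C : {set X}) (l : X -> Y) (F : Y -> nat) :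
  (\sum_(x in C) F (l x) = \sum_y #|[set x in C | l x == y]| * F y)%N.
Proof.
rewrite (partition_big l predT) //=; apply: eq_bigr => y _.
rewrite (eq_bigr (fun=> F y)) => [|x /andP[_ /eqP ->] //].
by rewrite sum_nat_const; congr (_ * _)%N; apply: eq_card => x; rewrite !inE.
Qed.

Lemma card_ffun_family (I X : finType) (F : I -> {set X}) :
  (#|[set v : {ffun I -> X} | [forall i, v i \in F i]]| = \prod_i #|F i|)%N.
Proof.
transitivity #|family (fun i => mem (F i))|.
  by apply: eq_card => v; rewrite inE; apply/forallP/familyP.
by rewrite card_family foldrE big_map big_enum.
Qed.

(** Exchanging the coordinates [i], [j] of [v] with a free pair is an injection; stating the bound
    as a product avoids the exponent [#|I| - 2]. *)
Lemma card_ffun_coord2 (I X : finType) (i j : I) (B : {set X * X}) : i != j ->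
  (#|[set v : {ffun I -> X} | (v i, v j) \in B]| * #|X| ^ 2 <=
   #|B| * #|X| ^ #|I|)%N.
Proof.
move=> ij; rewrite expnS expn1 -card_ffun -!cardsT -!cardsX.
pose phi (z : {ffun I -> X} * (X * X)) : (X * X) * {ffun I -> X} :=
  ((z.1 i, z.1 j),
   [ffun l => if l == i then z.2.1 else if l == j then z.2.2 else z.1 l]).
apply: (@card_le_inj _ _ _ _ phi) => [[v [a b]]|[v [a b]] [v' [a' b']] _ _ []].
  by rewrite !inE /= !andbT.
move=> vi vj /ffunP vE.
have := vE i; rewrite !ffunE eqxx => ->.
have := vE j; rewrite !ffunE eqxx eq_sym (negPf ij) => ->.
congr (_, _); apply/ffunP => l; have := vE l; rewrite !ffunE.
by case: eqP => [->|_] //; case: eqP => [->|].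
Qed.

(** The same exchange, with one coordinate in each of two vectors; here [i] and [j] may coincide. *)
Lemma card_ffun_pair_coord (I X Y : finType) (i j : I) (B : {set X * Y}) :
  (#|[set z : {ffun I -> X} * {ffun I -> Y} | (z.1 i, z.2 j) \in B]| *
     (#|X| * #|Y|) <=
   #|B| * (#|X| ^ #|I| * #|Y| ^ #|I|))%N.
Proof.
rewrite -!card_ffun -!cardsT -!cardsX.
pose phi (z : ({ffun I -> X} * {ffun I -> Y}) * (X * Y)) :
    (X * Y) * ({ffun I -> X} * {ffun I -> Y}) :=
  ((z.1.1 i, z.1.2 j),
   ([ffun l => if l == i then z.2.1 else z.1.1 l],
    [ffun l => if l == j then z.2.2 else z.1.2 l])).
apply: (@card_le_inj _ _ _ _ phi)
  => [[[u v] [a b]]|[[u v] [a b]] [[u' v'] [a' b']] _ _ []].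
  by rewrite !inE /= !andbT.
move=> ui vj /ffunP uE /ffunP vE.
have := uE i; rewrite !ffunE eqxx => ->.
have := vE j; rewrite !ffunE eqxx => ->.
congr ((_, _), _); apply/ffunP => l; [have := uE l | have := vE l];
  by rewrite !ffunE; case: eqP => [->|].
Qed.

End Counting.

(** * Averaging, Cauchy-Schwarz and absorption of constants *)

Section Averaging.
Variable R : realFieldType.

Lemma card_setR (X : finType) (P : pred X) :
  #|[set x | P x]|%:R = \sum_x (P x)%:R :> R.
Proof. by rewrite card_set_sum natr_sum. Qed.

Lemma exists_ge_average (I : finType) (B : {set I}) (F : I -> R) (m N : R) :
    0 < m -> 0 < N -> #|B|%:R <= N -> m * N <= \sum_(b in B) F b ->
  exists2 b, b \in B & m <= F b.
Proof.
move=> m0 N0 BN sumF; apply/exists_inP; apply: contraLR sumF.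
rewrite negb_exists_in => /forall_inP Flt; rewrite -ltNge.
have [B0|[b bB]] := set_0Vmem B; first by rewrite B0 big_set0 mulr_gt0.
apply: (@lt_le_trans _ _ (\sum_(b in B) m)); last first.
  by rewrite sumr_const -mulr_natr ler_pM2l.
rewrite (bigD1 b) //= [ltRHS](bigD1 b) //=; apply: ltr_leD.
  by rewrite ltNge Flt.
by apply: ler_sum => i /andP[iB _]; rewrite ltW // ltNge Flt.
Qed.

(** Cauchy-Schwarz against the constant sequence, read off from the nonnegative variance. *)
Lemma sqr_sum_le (I : finType) (B : {set I}) (a : I -> R) :
  (\sum_(i in B) a i) ^+ 2 <= #|B|%:R * \sum_(i in B) a i ^+ 2.
Proof.
have [->|Bn0] := eqVneq B set0; first by rewrite !big_set0 mulr0 expr0n.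
have N0 : (0 : R) < #|B|%:R by rewrite ltr0n card_gt0.
set m := \sum_(i in B) a i; set N : R := #|B|%:R.
have : 0 <= \sum_(i in B) (N * a i - m) ^+ 2 by apply: sumr_ge0 => i _; apply: sqr_ge0.
have -> : \sum_(i in B) (N * a i - m) ^+ 2 = N * (N * \sum_(i in B) a i ^+ 2 - m ^+ 2).
  have sq i : (N * a i - m) ^+ 2 = N ^+ 2 * a i ^+ 2 - (2 * N * m) * a i + m ^+ 2 by ring.
  rewrite (eq_bigr _ (fun i _ => sq i)).
  rewrite big_split /= sumrB -!mulr_sumr sumr_const -mulr_natr -/N -/m; ring.
by rewrite pmulr_rge0 // subr_ge0.
Qed.

Lemma sqr_sum_le_card (I : finType) (a : I -> R) :
  (\sum_i a i) ^+ 2 <= #|I|%:R * \sum_i a i ^+ 2.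
Proof.
have := sqr_sum_le [set: I] a; rewrite cardsT.
by under eq_bigl do rewrite inE; under [X in _ * X]eq_bigl do rewrite inE.
Qed.

(** One extra power of [d] pays for a factor 1000. All numerical constants below are absorbed in
    this way. *)
Lemma natr_mul_expr_le (d : R) (m a b j : nat) :
    0 <= d -> d <= 10 ^- 3 -> (m <= 1000 ^ j)%N -> (a + j <= b)%N ->
  m%:R * d ^+ b <= d ^+ a.
Proof.
move=> d0 d1 mj ab.
have d_le1 : d <= 1 by apply: le_trans d1 _; rewrite invf_le1 ?exprn_ege1 ?exprn_gt0 // ler1n.
apply: (@le_trans _ _ (m%:R * (d ^+ a * d ^+ j))).
  by rewrite -exprD ler_wpM2l ?ler0n // ler_wiXn2l.
rewrite mulrCA -[leRHS]mulr1 ler_wpM2l ?exprn_ge0 //.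
apply: (@le_trans _ _ ((1000 ^ j)%N%:R * (10 ^- 3) ^+ j)).
  apply: ler_pM; rewrite ?ler0n ?exprn_ge0 ?ler_nat //.
  by rewrite lerXn2r ?nnegrE // invr_ge0 exprn_ge0 ?ler0n.
rewrite natrX -exprMn (_ : 1000%:R * 10 ^- 3 = 1 :> R) ?expr1n //.
by rewrite -natrX divff // pnatr_eq0.
Qed.

End Averaging.

(** * Dependent random choice and prisms in a bipartite graph *)

Lemma prism_exponent1 (k : nat) : (100 <= k)%N -> (3 * k + 1 + k.-1 <= 4 * k)%N.
Proof. lia. Qed.

Lemma prism_exponent2 (k : nat) :
  (100 <= k)%N -> (3 * k + 1 + (4 * k + 6) * k <= 5 * k ^ 2)%N.
Proof. nia. Qed.

Lemma ord_pred_neq (r : nat) (j : 'I_r) : (2 <= r)%N -> ord_pred j != j.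
Proof.
move=> r2; have jr := ltn_ord j; apply/eqP => /(congr1 val) /=.
have [->|j0] := posnP j; first by rewrite add0n modn_small; lia.
have -> : ((j + r).-1 = j.-1 + r)%N by lia.
by rewrite modnDr modn_small; lia.
Qed.

Lemma ordS_neq (r : nat) (j : 'I_r) : (2 <= r)%N -> ordS j != j.
Proof.
move=> r2; rewrite -(inj_eq (can_inj (@ord_predK r))) ordSK eq_sym.
exact: ord_pred_neq.
Qed.

Section BipartiteGraph.
Variables (R : realFieldType) (S T : finType) (n : nat) (E : {set S * T}).
Hypotheses (cardS : #|S| = n) (cardT : #|T| = n) (n_gt0 : (0 < n)%N).

Local Notation N := (n%:R : R).
Local Notation chi x y := (((x, y) \in E)%:R : R).

Definition nbrs (p : S) : {set T} := [set y | (p, y) \in E].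

Definition common_nbrs (y w w' : T) : {set S} :=
  [set p | [&& (p, y) \in E, (p, w) \in E & (p, w') \in E]].

(** In a prism whose base cycle passes through [y], such a pair stands for the two T-vertices of the
    second cycle that must have a common neighbour with [y]. *)
Definition poor_pairs (eta : R) (U : {set T}) (y : T) : {set T * T} :=
  [set z : T * T | [&& z.1 \in U, z.2 \in U
                     & #|common_nbrs y z.1 z.2|%:R < eta * N]].

Let N_gt0 : 0 < N. Proof. by rewrite ltr0n. Qed.

Lemma card_edges : #|E|%:R = \sum_y \sum_x chi x y.
Proof.
rewrite exchange_big pair_bigA /= (_ : #|E| = #|[set e | e \in E]|) ?card_setR.
  by apply: eq_bigr => -[x y].
by apply: eq_card => e; rewrite inE.
Qed.

(** Both sides count the triples (x, p, y) in which [x] and [p] are neighbours of [y]. *)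
Lemma sum_edges_at_nbrs :
  \sum_p #|[set e in E | e.2 \in nbrs p]|%:R = \sum_y (\sum_x chi x y) ^+ 2.
Proof.
transitivity (\sum_p \sum_y \sum_x chi x y * chi p y).
  apply: eq_bigr => p _; rewrite card_setR exchange_big pair_bigA /=.
  by apply: eq_bigr => -[x y] _; rewrite !inE /= -natrM mulnb.
rewrite exchange_big; apply: eq_bigr => y _ /=.
by rewrite expr2 mulr_sumr; apply: eq_bigr => p _; rewrite mulr_suml.
Qed.

Lemma sum_edges_at_nbrs_ge (d : R) : 0 < d -> d * N ^+ 2 <= #|E|%:R ->
  d ^+ 2 * N ^+ 3 <= \sum_p #|[set e in E | e.2 \in nbrs p]|%:R.
Proof.
move=> d0 dE; rewrite sum_edges_at_nbrs -(ler_pM2l N_gt0).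
have := sqr_sum_le_card (fun y => \sum_x chi x y); rewrite cardT -card_edges.
apply: le_trans.
have -> : N * (d ^+ 2 * N ^+ 3) = (d * N ^+ 2) ^+ 2 by ring.
by rewrite lerXn2r ?nnegrE ?ler0n // mulr_ge0 ?exprn_ge0 ?ler0n // ltW.
Qed.

(** Of the n^3 triples in T, one with fewer than [eta * N] common neighbours lies in [nbrs p] for
    fewer than [eta * N] vertices [p]. *)
Lemma sum_poor_pairs (eta : R) : 0 < eta ->
  \sum_p \sum_(y in nbrs p) #|poor_pairs eta (nbrs p) y|%:R <= eta * N ^+ 4.
Proof.
move=> eta0.
have -> : eta * N ^+ 4 = \sum_(y : T) \sum_(z : T * T) eta * N.
  by rewrite !sumr_const -mulrnA -[RHS]mulr_natr card_prod cardT !natrM; ring.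
rewrite (eq_bigr (fun p => \sum_y \sum_z
    ((y \in nbrs p) && (z \in poor_pairs eta (nbrs p) y))%:R)); last first.
  move=> p _; rewrite big_mkcond; apply: eq_bigr => y _.
  case: (y \in nbrs p) => /=; last by rewrite big1.
  by rewrite /poor_pairs card_setR; apply: eq_bigr => z _; rewrite !inE.
rewrite exchange_big; apply: ler_sum => y _ /=.
rewrite exchange_big; apply: ler_sum => z _ /=.
case: (ltP #|common_nbrs y z.1 z.2|%:R (eta * N)) => [lt_eta|ge_eta].
  apply: le_trans (ltW lt_eta); rewrite card_setR; apply: ler_sum => p _.
  by rewrite !inE; do 3!case: (_ \in E); rewrite /= ?lt_eta.
rewrite big1 ?mulr_ge0 ?ler0n ?ltW // => p _.
by rewrite !inE (ltNge _ (eta * N)) ge_eta !andbF.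
Qed.

Lemma dependent_choice (d eta : R) :
    0 < d -> 0 < eta -> d * N ^+ 2 <= #|E|%:R ->
  exists p, d ^+ 2 / 2 * N ^+ 2 <= #|[set e in E | e.2 \in nbrs p]|%:R /\
    d ^+ 2 * (\sum_(y in nbrs p) #|poor_pairs eta (nbrs p) y|%:R) <=
      2 * eta * N ^+ 3.
Proof.
move=> d0 eta0 dE.
pose X p : R := #|[set e in E | e.2 \in nbrs p]|%:R.
pose Y p : R := \sum_(y in nbrs p) #|poor_pairs eta (nbrs p) y|%:R.
(* With this weight the total penalty for poor pairs is at most half of the guaranteed total of
   [X]. *)
pose lam := d ^+ 2 / (2 * eta * N).
have lam_ge0 : 0 <= lam by rewrite divr_ge0 ?exprn_ge0 ?mulr_ge0 ?ler0n // ltW.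
have Y_ge0 p : 0 <= Y p by apply: sumr_ge0 => y _; apply: ler0n.
have [||||p _ Fp] := @exists_ge_average R S [set: S] (fun p => X p - lam * Y p)
  (d ^+ 2 / 2 * N ^+ 2) N.
- by rewrite !mulr_gt0 ?invr_gt0 ?ltr0n.
- by [].
- by rewrite cardsT cardS.
- rewrite (eq_bigl predT) => [|p]; last by rewrite inE.
  rewrite sumrB -mulr_sumr.
  have := sum_edges_at_nbrs_ge d0 dE; have := sum_poor_pairs eta0.
  move=> /(ler_wpM2l lam_ge0).
  have -> : lam * (eta * N ^+ 4) = d ^+ 2 / 2 * N ^+ 3.
    by rewrite /lam; field; rewrite !gt_eqF.
  rewrite -/X -/Y; have -> : d ^+ 2 / 2 * N ^+ 2 * N = d ^+ 2 / 2 * N ^+ 3 by ring.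
  by set a := \sum_p _; set b := \sum_p _; rewrite /a /b; lra.
(* Positivity of [X p - lam * Y p] is used twice: it bounds [X p] from below, and, as
   [X p <= N ^+ 2], it bounds [Y p] from above. *)
exists p; split; first by have := mulr_ge0 lam_ge0 (Y_ge0 p); lra.
have XN : X p <= N ^+ 2.
  by rewrite -natrX ler_nat -[(n ^ 2)%N]/(n * n)%N -{1}cardS -cardT -card_prod max_card.
have lamY : lam * Y p <= N ^+ 2.
  have : 0 <= d ^+ 2 / 2 * N ^+ 2 by rewrite !mulr_ge0 ?invr_ge0 ?ler0n // ltW.
  lra.
have -> : d ^+ 2 * (\sum_(y in nbrs p) #|poor_pairs eta (nbrs p) y|%:R)
    = 2 * eta * N * (lam * Y p) by rewrite /lam -/(Y p); field; rewrite !gt_eqF.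
by rewrite (_ : 2 * eta * N ^+ 3 = 2 * eta * N * N ^+ 2); [rewrite ler_pM2l ?mulr_gt0 ?ltr0n|ring].
Qed.

(** Cauchy-Schwarz twice: over S it bounds the sum of the codegrees from below, and over pairs in T
    the sum of their squares, which counts the closed walks of length 4, degenerate ones
    included. *)
Lemma card_rectangles_ge :
  #|E|%:R ^+ 4 <= N ^+ 4 *
    #|[set z : (S * S) * (T * T) |
        [&& (z.1.1, z.2.1) \in E, (z.1.1, z.2.2) \in E,
            (z.1.2, z.2.2) \in E & (z.1.2, z.2.1) \in E]]|%:R.
Proof.
pose codeg (w : T * T) := \sum_x chi x w.1 * chi x w.2.
have EE : #|E|%:R ^+ 2 <= N * \sum_w codeg w.
  rewrite card_edges exchange_big /=; apply: le_trans (sqr_sum_le_card _) _.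
  rewrite cardS ler_wpM2l ?ler0n // le_eqVlt; apply/orP; left; apply/eqP.
  rewrite exchange_big; apply: eq_bigr => x _ /=.
  rewrite -(pair_bigA _ (fun y y' => chi x y * chi x y')) /= expr2 mulr_suml.
  by apply: eq_bigr => y _; rewrite mulr_sumr.
have codeg2 : \sum_w codeg w ^+ 2 = #|[set z : (S * S) * (T * T) |
        [&& (z.1.1, z.2.1) \in E, (z.1.1, z.2.2) \in E,
            (z.1.2, z.2.2) \in E & (z.1.2, z.2.1) \in E]]|%:R.
  rewrite card_setR.
  rewrite -(pair_bigA _ (fun (x : S * S) (w : T * T) => ([&& (x.1, w.1) \in E,
    (x.1, w.2) \in E, (x.2, w.2) \in E & (x.2, w.1) \in E])%:R)) exchange_big /=.
  apply: eq_bigr => w _.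
  rewrite -(pair_bigA _ (fun x x' => ([&& (x, w.1) \in E,
    (x, w.2) \in E, (x', w.2) \in E & (x', w.1) \in E])%:R)) /= expr2 mulr_suml.
  apply: eq_bigr => x _; rewrite mulr_sumr; apply: eq_bigr => x' _.
  by rewrite -!natrM !mulnb; do 4!case: (_ \in E).
have := sqr_sum_le_card codeg; rewrite card_prod cardT codeg2 natrM => CS.
have -> : #|E|%:R ^+ 4 = (#|E|%:R ^+ 2) ^+ 2 :> R by rewrite -exprM.
apply: (@le_trans _ _ ((N * \sum_w codeg w) ^+ 2)).
  by rewrite lerXn2r ?nnegrE ?exprn_ge0 ?ler0n // (le_trans _ EE) ?exprn_ge0 ?ler0n.
rewrite exprMn (_ : N ^+ 4 = N ^+ 2 * (N * N)); last by ring.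
by rewrite -mulrA ler_pM2l ?exprn_gt0.
Qed.

(* For [next := ordS], two 2r-cycles, on x, y and on z, joined by a perfect
   matching; [next := ord_pred] gives the same after exchanging the roles of S
   and T. *)
Definition prisms (r : nat) (next : 'I_r -> 'I_r) (x : 'I_r -> S) (y : 'I_r -> T) :
    {set {ffun 'I_r -> S} * {ffun 'I_r -> T}} :=
  [set z : {ffun 'I_r -> S} * {ffun 'I_r -> T} |
     [forall j, [&& (x j, z.2 j) \in E, (z.1 j, y j) \in E,
              (z.1 j, z.2 j) \in E & (z.1 (next j), z.2 j) \in E]]].

(** The T-vertices [v] of the second cycle are chosen first, with [v j] in [nbrs (x j) :&: U]; a
    union bound removes the choices in which some [(v j, v (prev j))] is poor for [y j]. Each
    S-vertex [u j] then has at least [eta * N] independent choices among the common neighbours of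
    [y j], [v j] and [v (prev j)]. *)
Lemma card_prisms_ge (a zeta eta : R) (U : {set T}) (r : nat)
    (next prev : 'I_r -> 'I_r) (x : 'I_r -> S) (y : 'I_r -> T) :
    cancel next prev -> (forall j, prev j != j) -> 0 <= a -> 0 <= eta ->
    (forall j, a * N <= #|nbrs (x j) :&: U|%:R) ->
    (forall j, #|poor_pairs eta U (y j)|%:R <= zeta * N ^+ 2) ->
  (a ^+ r - r%:R * zeta) * eta ^+ r * N ^+ (2 * r) <= #|prisms next x y|%:R.
Proof.
move=> nextK prev_neq a0 eta0 xU yU.
pose V := [set v : {ffun 'I_r -> T} | [forall j, v j \in nbrs (x j) :&: U]].
pose B j := [set v : {ffun 'I_r -> T} |
               (v j, v (prev j)) \in poor_pairs eta U (y j)].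
have cardV : a ^+ r * N ^+ r <= #|V|%:R.
  rewrite card_ffun_family natr_prod -exprMn -[in leLHS](card_ord r) -prodr_const.
  by apply: ler_prod => j _; rewrite mulr_ge0 ?ler0n // xU.
have cardB j : #|B j|%:R <= zeta * N ^+ r.
  have := @card_ffun_coord2 _ T j (prev j) (poor_pairs eta U (y j)).
  rewrite eq_sym prev_neq => /(_ isT); rewrite -/(B j) card_ord cardT.
  rewrite -(ler_nat R) !natrM !natrX => BN.
  rewrite -(ler_pM2r (exprn_gt0 2 N_gt0)); apply: le_trans BN _.
  by rewrite mulrAC ler_wpM2r ?exprn_ge0 ?ler0n.
pose W := V :\: \bigcup_j B j.
have cardW : (a ^+ r - r%:R * zeta) * N ^+ r <= #|W|%:R.
  have VW : (#|V| <= #|W| + \sum_j #|B j|)%N.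
    rewrite -(cardsID (\bigcup_j B j) V) addnC leq_add2l.
    apply: leq_trans (subset_leq_card (subsetIr _ _)) _.
    elim/big_rec2: _ => [|j m X _ Xm]; first by rewrite cards0.
    by rewrite (leq_trans (leq_card_setU _ _).1) // leq_add2l.
  have : \sum_j #|B j|%:R <= r%:R * zeta * N ^+ r.
    have -> : r%:R * zeta * N ^+ r = \sum_(j < r) zeta * N ^+ r.
      by rewrite sumr_const card_ord -[RHS]mulr_natr; ring.
    by apply: ler_sum => j _; apply: cardB.
  move: VW; rewrite -(ler_nat R) natrD natr_sum; lra.
have prismE : (#|prisms next x y| >= \sum_(v in W)
    #|[set u : {ffun 'I_r -> S} |
        [forall j, u j \in common_nbrs (y j) (v j) (v (prev j))]]|)%N.
  rewrite -(card_set_dep W (fun v : {ffun 'I_r -> T} => [set u : {ffun 'I_r -> S} |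
    [forall j, u j \in common_nbrs (y j) (v j) (v (prev j))]])).
  apply: (@card_le_inj _ _ _ _ (fun z => (z.2, z.1)));
    last by move=> [? ?] [? ?] _ _ [-> ->].
  move=> [v u]; rewrite !inE /= => /andP[/andP[_ /forallP vV] /forallP uC].
  apply/forallP => j; have := vV j; have := uC j; have := uC (next j).
  by rewrite nextK !inE => /and3P[_ _ ->] /and3P[-> -> _] /andP[-> _].
apply: (@le_trans _ _ (\sum_(v in W) (eta * N) ^+ r)).
  rewrite sumr_const -[leRHS]mulr_natl exprMn.
  have -> : (a ^+ r - r%:R * zeta) * eta ^+ r * N ^+ (2 * r) =
    ((a ^+ r - r%:R * zeta) * N ^+ r) * (eta ^+ r * N ^+ r).
    by rewrite mul2n -addnn exprD; ring.
  by rewrite ler_wpM2r // mulr_ge0 ?exprn_ge0 ?ler0n.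
apply: (@le_trans _ _ (\sum_(v in W) #|[set u : {ffun 'I_r -> S} |
        [forall j, u j \in common_nbrs (y j) (v j) (v (prev j))]]|)%N%:R);
  last by rewrite ler_nat.
rewrite natr_sum; apply: ler_sum => v; rewrite !inE => /andP[vB /forallP vV].
rewrite card_ffun_family natr_prod -[in leLHS](card_ord r) -prodr_const.
apply: ler_prod => j _; rewrite mulr_ge0 ?ler0n //= leNgt.
apply: contra vB => poor; apply/bigcupP; exists j => //.
have := vV j; have := vV (prev j).
by rewrite !inE /= => /andP[_ ->] /andP[_ ->].
Qed.

(** [E'] keeps the edges whose S-end has many neighbours in [U = nbrs p] and whose T-end lies in [U]
    and has few poor pairs, which are the hypotheses of [card_prisms_ge]. The prisms themselves are
    found in [E], so their second cycle may leave [E']. *)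
Lemma prism_subgraph (d : R) (k : nat) :
    0 < d -> d <= 10 ^- 3 -> (100 <= k)%N -> d * N ^+ 2 <= #|E|%:R ->
  exists E' : {set S * T}, [/\ E' \subset E, d ^+ 3 * N ^+ 2 <= #|E'|%:R &
    forall (r : nat) (next prev : 'I_r -> 'I_r) (x : 'I_r -> S) (y : 'I_r -> T), (2 <= r <= k)%N ->
      cancel next prev -> (forall j, prev j != j) ->
      (forall j, (x j, y j) \in E') ->
      d ^+ (5 * k ^ 2) * N ^+ (2 * r) <= #|prisms next x y|%:R].
Proof.
move=> d0 d1 k100 dE; have d_ge0 := ltW d0.
have pow m a b j := @natr_mul_expr_le R d m a b j d_ge0 d1.
(* [zeta] is small enough for [r * zeta] to be negligible against (d^2/8)^r >= d^(3k). The factor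
   d^6 in [eta] makes [U :\: U'] of size at most 2 d^4 N. *)
pose zeta := d ^+ (4 * k); pose eta := d ^+ (4 * k + 6).
have zeta0 : 0 < zeta by rewrite exprn_gt0.
have eta0 : 0 < eta by rewrite exprn_gt0.
have [p [Xp Yp]] := dependent_choice d0 eta0 dE.
set U := nbrs p in Xp Yp.
pose S' := [set x | d ^+ 2 / 8 * N <= #|nbrs x :&: U|%:R].
pose U' := [set y in U | #|poor_pairs eta U y|%:R <= zeta * N ^+ 2].
pose E' := [set e in E | (e.1 \in S') && (e.2 \in U')].
have lostS : #|[set e in E | (e.2 \in U) && (e.1 \notin S')]|%:R <= d ^+ 2 / 8 * N ^+ 2.
  have -> : [set e in E | (e.2 \in U) && (e.1 \notin S')] =
      [set e | ((e.1, e.2) \in E) && ((e.2 \in U) && (e.1 \notin S'))].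
    by apply/setP => -[x y]; rewrite !inE.
  rewrite (card_set_pair (fun x y => ((x, y) \in E) && ((y \in U) && (x \notin S')))).
  rewrite natr_sum.
  have -> : d ^+ 2 / 8 * N ^+ 2 = \sum_(x : S) d ^+ 2 / 8 * N.
    by rewrite sumr_const cardS -[RHS]mulr_natr; ring.
  apply: ler_sum => x _; have [xS|xS] := boolP (x \in S').
    rewrite (_ : [set _ | _] = set0) ?cards0 ?mulr_ge0 ?invr_ge0 ?exprn_ge0 ?ler0n //.
    by apply/setP => y; rewrite !inE !andbF.
  rewrite (_ : [set _ | _] = nbrs x :&: U); last by apply/setP => y; rewrite !inE andbT.
  by move: xS; rewrite inE -ltNge => /ltW.
have lostU : #|[set e in E | (e.2 \in U) && (e.2 \notin U')]|%:R <= d ^+ 2 / 8 * N ^+ 2.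
  have UU : #|U :\: U'|%:R * (zeta * N ^+ 2) * d ^+ 2 <= 2 * eta * N ^+ 3.
    apply: le_trans Yp; rewrite mulrC ler_pM2l ?exprn_gt0 // mulr_natl -sumr_const.
    apply: (@le_trans _ _ (\sum_(y in U :\: U') #|poor_pairs eta U y|%:R)).
      apply: ler_sum => y; rewrite !inE => /andP[+ yU]; rewrite yU /= -ltNge.
      exact: ltW.
    by rewrite [leRHS](big_setID U') lerDr sumr_ge0 // => y _; apply: ler0n.
  apply: (@le_trans _ _ (#|U :\: U'|%:R * N)).
    rewrite -natrM ler_nat -cardS mulnC -cardsT -cardsX subset_leq_card //.
    by apply/subsetP => e; rewrite !inE => /and3P[_ -> ->].
  rewrite expr2 mulrA ler_pM2r //.
  have dz : 0 < zeta * N ^+ 2 * d ^+ 2 by rewrite !mulr_gt0 ?exprn_gt0.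
  rewrite -(ler_pM2r dz) mulrA; apply: le_trans UU _.
  have -> : eta = zeta * d ^+ 2 * d ^+ 4 by rewrite /eta /zeta -mulrA -!exprD.
  have -> : d ^+ 2 / 8 * N * (zeta * N ^+ 2 * d ^+ 2) =
     zeta * d ^+ 2 * N ^+ 3 * (d ^+ 2 / 8) by ring.
  have -> : 2 * (zeta * d ^+ 2 * d ^+ 4) * N ^+ 3 =
     zeta * d ^+ 2 * N ^+ 3 * (2 * d ^+ 4) by ring.
  rewrite ler_pM2l ?mulr_gt0 ?exprn_gt0 //.
  by have := @pow 16%N 2%N 4%N 1%N isT isT; lra.
have cover : (#|[set e in E | e.2 \in U]| <= #|E'| +
   #|[set e in E | (e.2 \in U) && (e.1 \notin S')]| +
   #|[set e in E | (e.2 \in U) && (e.2 \notin U')]|)%N.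
  apply: leq_trans (leq_trans (leq_card_setU _ _).1 (leq_add (leq_card_setU _ _).1 (leqnn _))).
  apply: subset_leq_card; apply/subsetP => -[x y]; rewrite !inE /=.
  by case/andP => -> -> /=; do 2!case: (_ <= _).
exists E'; split.
- by apply/subsetP => e; rewrite inE => /andP[].
(* Two losses of d^2/8 from d^2/2 leave the density d^2/4. *)
- have d23 : d ^+ 3 <= d ^+ 2 / 4 by have := @pow 4%N 2%N 3%N 1%N isT isT; lra.
  apply: (@le_trans _ _ (d ^+ 2 / 4 * N ^+ 2)); first by rewrite ler_wpM2r ?exprn_ge0.
  move: cover; rewrite -(ler_nat R) !natrD; lra.
move=> r next prev x y /andP[r2 rk] nextK prev_neq xyE.
have xS j : x j \in S' by have := xyE j; rewrite inE => /and3P[].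
have yU j : y j \in U' by have := xyE j; rewrite inE => /and3P[].
have cnt : (((d ^+ 2 / 8) ^+ r - r%:R * zeta) * eta ^+ r * N ^+ (2 * r)
    <= #|prisms next x y|%:R).
  apply: (@card_prisms_ge (d ^+ 2 / 8) zeta eta U _ _ prev) => //.
  - by rewrite divr_ge0 ?exprn_ge0.
  - exact: ltW.
  - by move=> j; have := xS j; rewrite inE.
  - by move=> j; have := yU j; rewrite inE => /andP[].
apply: le_trans cnt; rewrite ler_wpM2r ?exprn_ge0 ?ler0n //.
have d_le1 : d <= 1 by have := @pow 1%N 0%N 1%N 1%N isT isT; rewrite mul1r.
have d3r : d ^+ (3 * k) <= (d ^+ 2 / 8) ^+ r.
  apply: (@le_trans _ _ (d ^+ (3 * r))); first by rewrite ler_wiXn2l ?leq_mul2l.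
  rewrite exprM lerXn2r ?nnegrE ?exprn_ge0 ?divr_ge0 ?exprn_ge0 //.
  by have := @pow 8%N 2%N 3%N 1%N isT isT; lra.
have rz : r%:R * zeta <= d ^+ (3 * k + 1).
  apply: (@pow r (3 * k + 1)%N (4 * k)%N k.-1); last first.
    exact: prism_exponent1.
  by apply: leq_trans rk _; case: (k) k100 => // k' _; rewrite /= ltn_expl.
have dd : d ^+ (3 * k + 1) <= d ^+ (3 * k) - r%:R * zeta.
  by have := @pow 2%N (3 * k)%N (3 * k + 1)%N 1%N isT (leqnn _); lra.
apply: (@le_trans _ _ (d ^+ (3 * k + 1) * d ^+ ((4 * k + 6) * k))).
  by rewrite -exprD ler_wiXn2l // prism_exponent2.
apply: ler_pM; rewrite ?exprn_ge0 //; first by lra.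
by rewrite /eta -exprM ler_wiXn2l // leq_mul2l rk orbT.
Qed.

End BipartiteGraph.

(** * Positions in a 2r-cycle and the vertices they carry *)

Section CyclicIndices.
Variable r : nat.

Lemma half_index_subproof (i : 'I_(2 * r)) : (i./2 < r)%N.
Proof. by have := ltn_ord i; lia. Qed.

Lemma even_index_subproof (j : 'I_r) : (2 * j < 2 * r)%N.
Proof. by rewrite ltn_mul2l ltn_ord. Qed.

(* In a 2r-cycle with pattern (s, t), the position i carries the class-s vertex
   number [half_index i] and the class-t vertex number [next_half_index i]. *)
Definition half_index (i : 'I_(2 * r)) : 'I_r := Ordinal (half_index_subproof i).
Definition next_half_index (i : 'I_(2 * r)) : 'I_r :=
  if odd i then ordS (half_index i) else half_index i.
Definition even_index (j : 'I_r) : 'I_(2 * r) := Ordinal (even_index_subproof j).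

Lemma even_indexK (i : 'I_(2 * r)) : ~~ odd i -> even_index (half_index i) = i.
Proof. by move=> oi; apply: val_inj => /=; lia. Qed.

Lemma ordS_even (i : 'I_(2 * r)) : ~~ odd i -> ordS i = i.+1 :> nat.
Proof. by move=> oi /=; rewrite modn_small //; have := ltn_ord i; lia. Qed.

Lemma odd_ordS (i : 'I_(2 * r)) : odd (ordS i) = ~~ odd i.
Proof. by rewrite /= odd_mod ?oddM. Qed.

Lemma half_index_ordS (i : 'I_(2 * r)) :
  half_index (ordS i) = next_half_index i.
Proof.
rewrite /next_half_index; have [oi|oi] := ifP; apply: val_inj => /=.
  have -> : i.+1 = (2 * (i./2).+1)%N by lia.
  by rewrite -muln_modr mul2n doubleK.
by have := ordS_even (negbT oi) => /= ->; lia.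
Qed.

Lemma half_index_even (j : 'I_r) : half_index (even_index j) = j.
Proof. by apply: val_inj => /=; rewrite mul2n doubleK. Qed.

Lemma next_half_index_even (j : 'I_r) : next_half_index (even_index j) = j.
Proof. by rewrite /next_half_index /= mul2n odd_double half_index_even. Qed.

Lemma next_half_index_ordS_odd (i : 'I_(2 * r)) :
  odd i -> next_half_index (ordS i) = next_half_index i.
Proof.
by move=> oi; rewrite {1}/next_half_index odd_ordS oi half_index_ordS.
Qed.

Lemma half_index_ordS_even (i : 'I_(2 * r)) :
  ~~ odd i -> half_index (ordS i) = half_index i.
Proof. by move=> oi; rewrite half_index_ordS /next_half_index (negPf oi). Qed.

End CyclicIndices.

(** * Linear hypergraphs and the translation of faces between bases *)

Section Faces.
Variable V : 'I_3 -> finType.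
Implicit Types (A G : {set face V}) (e f : face V).

Lemma linear_eq A i j f g : linear_hypergraph A -> i != j ->
  f \in A -> g \in A -> f i = g i -> f j = g j -> f = g.
Proof.
move=> lA ij fA gA fi fj; have /card_le1_eqP := lA i j (g i) (g j) ij; apply.
  by rewrite inE gA !eqxx.
by rewrite inE fA fi fj !eqxx.
Qed.

Lemma linear_subset A G : G \subset A -> linear_hypergraph A -> linear_hypergraph G.
Proof.
move=> GA lA i j u w ij; apply: leq_trans (lA i j u w ij).
by apply: subset_leq_card; apply/subsetP => f; rewrite !inE => /andP[/(subsetP GA) ->].
Qed.

(** The positions 2j, 2j+1 share a class-s vertex and the positions 2j-1, 2j a class-t vertex, so
    the even positions carry all vertices of the cycle. *)
Lemma cycle_half_index (s t : 'I_3) (r : nat) (f : face_seq V r) i :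
    is_cycle s t f ->
  f i s = f (even_index (half_index i)) s /\
  f i t = f (even_index (next_half_index i)) t.
Proof.
move=> /forallP fC; have [oi|oi] := boolP (odd i); last first.
  by rewrite /next_half_index (negPf oi) even_indexK.
split; last first.
  have := fC i; rewrite oi => /eqP ->; rewrite -half_index_ordS even_indexK //.
  by rewrite odd_ordS oi.
have := fC (even_index (half_index i)).
rewrite /= mul2n odd_double => /eqP ->; congr (f _ s); apply: ord_inj.
by rewrite ordS_even /= ?mul2n ?odd_double //; lia.
Qed.

Lemma is_cycle_half_index (s t : 'I_3) (r : nat) (f : face_seq V r)
    (x : 'I_r -> V s) (y : 'I_r -> V t) :
    (forall i, f i s = x (half_index i)) ->
    (forall i, f i t = y (next_half_index i)) ->
  is_cycle s t f.
Proof.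
move=> fx fy; apply/forallP => i; case: ifP => oi.
  by rewrite !fy next_half_index_ordS_odd.
by rewrite !fx half_index_ordS_even ?oi.
Qed.

Lemma rectangle_cycle A (s t : 'I_3) f h' g h :
    f \in A -> h' \in A -> g \in A -> h \in A ->
    f s = h' s -> h' t = g t -> g s = h s -> h t = f t ->
  rectangle f h' g h \in cycles A s t 2.
Proof.
move=> fA hA' gA hA fs ht gs ht'; rewrite inE; apply/andP; split.
  by apply/forallP; case=> -[|[|[|[|]]]] // ?; rewrite ffunE.
by apply/forallP; case=> -[|[|[|[|]]]] // ?;
  rewrite !ffunE /= ?fs ?ht ?gs ?ht'.
Qed.

Definition linked A (c s t : 'I_3) e e' f f' : bool :=
  [exists a in A, exists a' in A,
     [&& a c == a' c, a s == e s, a t == f t, a' s == e' s & a' t == f' t]].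

(** When [e] and [e'] have the same label, this gives two rectangles with equal labels, one with
    opposite corners [e], [f] and one with opposite corners [e'], [f']; together they form an
    octahedron. *)
Definition translated A (c s t : 'I_3) e e' f f' : bool :=
  [&& f c == f' c, linked A c s t e e' f f' & linked A c t s e e' f f'].

(* The faces opposite to e in the rectangles that start at e and have a copy
   with the same labels starting at e'. *)
Definition opposite_faces A (c s t : 'I_3) (b : face V * face V) : {set face V} :=
  [set f in A | [exists f' in A, translated A c s t b.1 b.2 f f']].

Definition base_pairs A (c : 'I_3) : {set face V * face V} :=
  [set b : face V * face V | [&& b.1 \in A, b.2 \in A & b.1 c == b.2 c]].

Lemma linkedP A c s t e e' f f' :
  reflect (exists a a', [/\ a \in A, a' \in A, a c = a' c &
             [/\ a s = e s, a t = f t, a' s = e' s & a' t = f' t]])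
          (linked A c s t e e' f f').
Proof.
apply: (iffP exists_inP) => [[a aA /exists_inP[a' aA']]|[a [a' [aA aA' ac]]]].
  by case/and5P => /eqP ? /eqP ? /eqP ? /eqP ? /eqP ?; exists a, a'.
case=> as_ at_ as' at'; exists a => //; apply/exists_inP; exists a' => //.
by rewrite ac as_ at_ as' at' !eqxx.
Qed.

Lemma opposite_facesC A c s t : opposite_faces A c s t =1 opposite_faces A c t s.
Proof.
move=> b; apply/setP => f; rewrite !inE; congr (_ && _).
by apply: eq_existsb => f'; rewrite /translated [X in _ && (_ && X)]andbC.
Qed.

Section Linear.
Variables (n : nat) (A : {set face V}) (c s t : 'I_3).
Hypotheses (cardV : forall j, #|V j| = n) (linA : linear_hypergraph A).
Hypotheses (cs : c != s) (ct : c != t) (st : s != t).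

Lemma card_faces_le : (#|A| <= n ^ 2)%N.
Proof.
rewrite -[(n ^ 2)%N]/(n * n)%N -{1}(cardV s) -(cardV t) -card_prod -cardsT.
apply: (@card_le_inj _ _ _ _ (fun f : face V => (f s, f t))) => // f g fA gA [].
exact: linear_eq linA st fA gA.
Qed.

(** Two vertices determine the first face; one more determines the second, whose label is already
    known. *)
Lemma card_base_pairs_le : (#|base_pairs A c| <= n ^ 3)%N.
Proof.
rewrite (_ : n ^ 3 = n * n * n)%N; last by rewrite !expnS expn0 muln1 mulnA.
rewrite -{1}(cardV s) -{1}(cardV t) -(cardV s) -!card_prod -cardsT.
apply: (@card_le_inj _ _ _ _ (fun b : face V * face V => (b.1 s, b.1 t, b.2 s))) => //.
move=> [e e'] [g g']; rewrite !inE /= => /and3P[eA eA' /eqP ec] /and3P[gA gA' /eqP gc].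
move=> [es et es']; have eg : e = g by apply: linear_eq linA st eA gA es et.
by congr (_, _) => //; apply: linear_eq linA cs eA' gA' _ es'; rewrite -ec -gc eg.
Qed.

Lemma card_cycles_le (r : nat) : (#|cycles A s t r| <= n ^ (2 * r))%N.
Proof.
have -> : (n ^ (2 * r) = #|[set: {ffun 'I_r -> V s} * {ffun 'I_r -> V t}]|)%N.
  by rewrite cardsT card_prod !card_ffun !cardV !card_ord -expnD addnn -mul2n.
apply: (@card_le_inj _ _ _ _ (fun f : face_seq V r =>
  ([ffun j => f (even_index j) s], [ffun j => f (even_index j) t]))) => //.
move=> f g; rewrite !inE => /andP[/forallP fA fC] /andP[/forallP gA gC].
case=> /ffunP fgs /ffunP fgt; apply/ffunP => i.
have [fs ft] := cycle_half_index i fC; have [gs gt] := cycle_half_index i gC.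
apply: linear_eq linA st (fA i) (gA i) _ _.
  by rewrite fs gs; have := fgs (half_index i); rewrite !ffunE.
by rewrite ft gt; have := fgt (next_half_index i); rewrite !ffunE.
Qed.

(** Translation acts on class-t vertices: [e s] and [f t] determine the corner [a], then its label
    and [e' s] determine [a'], hence [f' t]. *)
Lemma linked_eq e e' f f' g g' :
    linked A c s t e e' f f' -> linked A c s t e e' g g' -> f t = g t ->
  f' t = g' t.
Proof.
case/linkedP => a [a' [aA aA' ac [as_ at_ as' at']]].
case/linkedP => b [b' [bA bA' bc [bs bt bs' bt']]] fg.
have ab : a = b by apply: linear_eq linA st aA bA _ _; rewrite ?as_ ?bs ?at_ ?bt.
have ab' : a' = b'.
  by apply: linear_eq linA cs aA' bA' _ _; rewrite -?ac -?bc ?ab // as' bs'.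
by rewrite -at' -bt' ab'.
Qed.

(** The same chain read backwards: the label of [a] and [f' t] determine [a'], hence the class-s
    vertex of the second base. *)
Lemma linked_base_eq e e' e'' f f' :
    linked A c s t e e' f f' -> linked A c s t e e'' f f' -> e' s = e'' s.
Proof.
case/linkedP => a [a' [aA aA' ac [as_ at_ as' at']]].
case/linkedP => b [b' [bA bA' bc [bs bt bs' bt']]].
have ab : a = b by apply: linear_eq linA st aA bA _ _; rewrite ?as_ ?bs ?at_ ?bt.
have ab' : a' = b'.
  by apply: linear_eq linA ct aA' bA' _ _; rewrite -?ac -?bc ?ab // at' bt'.
by rewrite -as' -bs' ab'.
Qed.

End Linear.
End Faces.

(** * Octahedra as pairs of 4-cycles with equal labels *)

Section Octahedra.
Variables (V : 'I_3 -> finType) (A : {set face V}) (c s t : 'I_3).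
Hypotheses (cs : c != s) (ct : c != t) (st : s != t).

Definition cube_vertex (x y z : bool) : {ffun 'I_3 -> bool} :=
  [ffun l => if l == c then x else if l == s then y else z].

Lemma cube_vertexE x y z :
  (cube_vertex x y z c = x) * (cube_vertex x y z s = y) * (cube_vertex x y z t = z).
Proof.
by rewrite !ffunE !eqxx (eq_sym s c) (eq_sym t c) (eq_sym t s) (negPf cs) (negPf ct) (negPf st).
Qed.

Lemma class_cases (l : 'I_3) : [|| l == c, l == s | l == t].
Proof.
move: cs ct st; rewrite -!val_eqE /=.
have := ltn_ord l; have := ltn_ord c; have := ltn_ord s; have := ltn_ord t.
by move: (l : nat) (c : nat) (s : nat) (t : nat) => l' c' s' t'; lia.
Qed.

Lemma cube_vertex_eta (w : {ffun 'I_3 -> bool}) : w = cube_vertex (w c) (w s) (w t).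
Proof.
apply/ffunP => l; have /or3P[] := class_cases l => /eqP ->;
  by rewrite cube_vertexE.
Qed.

Lemma octahedron_share (T : {ffun {ffun 'I_3 -> bool} -> face V}) :
    is_octahedron T ->
  [/\ forall x x' y z, T (cube_vertex x y z) c = T (cube_vertex x' y z) c,
      forall x y y' z, T (cube_vertex x y z) s = T (cube_vertex x y' z) s
    & forall x y z z', T (cube_vertex x y z) t = T (cube_vertex x y z') t].
Proof.
move=> /forallP T_oct.
have share j (w w' : {ffun 'I_3 -> bool}) : (forall l, l != j -> w l = w' l) -> T w j = T w' j.
  move=> ww'; have /forallP/(_ w)/forallP/(_ w')/implyP := T_oct j.
  by move=> T_eq; apply/eqP/T_eq/forall_inP => l lj; rewrite ww'.
split=> *; apply: share => l lj; rewrite !ffunE; do !case: ifP => //.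
- by rewrite (negPf lj).
- by rewrite (negPf lj).
move=> ls lc; have := class_cases l; by rewrite ls lc (negPf lj).
Qed.

(** The faces at 000, 100 and 011, in the coordinates (c, s, t), form a base pair and an opposite
    face; linearity recovers the other five. *)
Lemma card_octahedra_le : linear_hypergraph A ->
  (#|octahedra A| <= \sum_(b in base_pairs A c) #|opposite_faces A c s t b|)%N.
Proof.
move=> linA; rewrite -card_set_dep.
pose phi (T : {ffun {ffun 'I_3 -> bool} -> face V}) :=
  ((T (cube_vertex false false false), T (cube_vertex true false false)),
   T (cube_vertex false true true)).
apply: (@card_le_inj _ _ _ _ phi) => [T|T T'].
  rewrite inE => /andP[/forallP TA /octahedron_share[Tc Ts Tt]].
  rewrite !inE !TA /= (Tc _ true) eqxx /=.
  apply/exists_inP; exists (T (cube_vertex true true true)); first exact: TA.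
  apply/and3P; split; first by rewrite (Tc _ true).
    apply/linkedP; exists (T (cube_vertex false true false)),
      (T (cube_vertex true true false)).
    by split=> //; split; do ?[exact: Ts | exact: Tt].
  apply/linkedP; exists (T (cube_vertex false false true)),
    (T (cube_vertex true false true)).
  by split=> //; split; do ?[exact: Ts | exact: Tt].
rewrite !inE => /andP[/forallP TA /octahedron_share[Tc Ts Tt]].
move=> /andP[/forallP TA' /octahedron_share[Tc' Ts' Tt']] [].
set w := cube_vertex => e000 e100 e011.
have e010 : T (w false true false) = T' (w false true false).
  apply: linear_eq linA st (TA _) (TA' _) _ _.
    by rewrite (Ts _ _ false) (Ts' _ _ false) e000.
  by rewrite (Tt _ _ _ true) (Tt' _ _ _ true) e011.
have e001 : T (w false false true) = T' (w false false true).
  apply: linear_eq linA st (TA _) (TA' _) _ _.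
    by rewrite (Ts _ _ true) (Ts' _ _ true) e011.
  by rewrite (Tt _ _ _ false) (Tt' _ _ _ false) e000.
have e110 : T (w true true false) = T' (w true true false).
  apply: linear_eq linA cs (TA _) (TA' _) _ _.
    by rewrite (Tc _ false) (Tc' _ false) e010.
  by rewrite (Ts _ _ false) (Ts' _ _ false) e100.
have e101 : T (w true false true) = T' (w true false true).
  apply: linear_eq linA ct (TA _) (TA' _) _ _.
    by rewrite (Tc _ false) (Tc' _ false) e001.
  by rewrite (Tt _ _ _ false) (Tt' _ _ _ false) e100.
have e111 : T (w true true true) = T' (w true true true).
  apply: linear_eq linA ct (TA _) (TA' _) _ _.
    by rewrite (Tc _ false) (Tc' _ false) e011.
  by rewrite (Tt _ _ _ false) (Tt' _ _ _ false) e110.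
apply/ffunP => v; rewrite (cube_vertex_eta v).
by case: (v c); case: (v s); case: (v t).
Qed.

(* The position in a 4-cycle with pattern (s, t) of the cube vertex with
   coordinates y, z in the directions s, t. *)
Definition rectangle_index (y z : bool) : 'I_(2 * 2) :=
  if z then (if y then inord 2 else inord 3) else (if y then inord 1 else inord 0).

(** Two 4-cycles with the same labels are the layers [w c = false] and [w c = true] of an
    octahedron. *)
Lemma card_octahedra_ge :
  (\sum_(f in cycles A s t 2)
     #|[set g in cycles A s t 2 | labels c g == labels c f]| <= #|octahedra A|)%N.
Proof.
rewrite -card_set_dep.
pose phi (z : face_seq V 2 * face_seq V 2) :
    {ffun {ffun 'I_3 -> bool} -> face V} :=
  [ffun w : {ffun 'I_3 -> bool} => (if w c then z.2 else z.1) (rectangle_index (w s) (w t))].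
have share (f : face_seq V 2) : is_cycle s t f ->
    (forall y y' z, f (rectangle_index y z) s = f (rectangle_index y' z) s) /\
    (forall y z z', f (rectangle_index y z) t = f (rectangle_index y z') t).
  move=> /forallP fC.
  have sE (i : nat) : (i < 3)%N -> ordS (inord i : 'I_(2 * 2)) = inord i.+1.
    move=> i3; apply: val_inj => /=.
    have i4 : (i < 4)%N by apply: leq_trans i3 _.
    by rewrite !inordK // modn_small.
  have f0 := fC (inord 0); have f1 := fC (inord 1); have f2 := fC (inord 2).
  have f3 := fC (inord 3); move: f0 f1 f2 f3.
  rewrite !inordK // (sE 0%N) // (sE 1%N) // (sE 2%N) //= => /eqP f0 /eqP f1 /eqP f2.
  rewrite (_ : ordS (inord 3) = inord 0 :> 'I_(2 * 2)) => [/eqP f3|]; last first.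
    by apply: val_inj => /=; rewrite !inordK.
  by split=> [[] [] []|[] [] []].
apply: (@card_le_inj _ _ _ _ phi) => [[f g]|[f g] [f' g'] _ _ /ffunP fg].
  rewrite !inE => /andP[/andP[/forallP fA fC] /andP[/andP[/forallP gA gC] lab]].
  apply/andP; split; first by apply/forallP => w; rewrite ffunE; case: ifP.
  have [fs ft] := share f fC; have [gs gt] := share g gC.
  have fgc i : f i c = g i c by move/eqP/ffunP/(_ i): lab; rewrite !ffunE.
  apply/forallP => j; apply/forallP => w; apply/forallP => w'.
  apply/implyP => /forall_inP ww; rewrite !ffunE /=; apply/eqP.
  have /or3P[] := class_cases j => /eqP jE; rewrite {}jE in ww *.
  - rewrite (eqP (ww s _)) 1?eq_sym // (eqP (ww t _)) 1?eq_sym //.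
    by do 2!case: ifP.
  - by rewrite (eqP (ww c cs)) (eqP (ww t _)) 1?eq_sym //; case: ifP.
  - by rewrite (eqP (ww c ct)) (eqP (ww s st)); case: ifP.
have surj i : exists y z, i = rectangle_index y z.
  case: i => -[|[|[|[|//]]]] i4; [exists false, false | exists true, false
    | exists true, true | exists false, true]; by apply: val_inj; rewrite /= inordK.
congr (_, _); apply/ffunP => i; have [y [z ->]] := surj i.
  by have := fg (cube_vertex false y z); rewrite [LHS]ffunE [RHS]ffunE !cube_vertexE.
by have := fg (cube_vertex true y z); rewrite [LHS]ffunE [RHS]ffunE !cube_vertexE.
Qed.

End Octahedra.

(** * Faces as edges of a bipartite graph *)

Section Edges.
Variables (V : 'I_3 -> finType) (A : {set face V}) (s t : 'I_3) (f0 : face V).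

Definition edges : {set V s * V t} := [set (f s, f t) | f : face V in A].

(** Inverse of the edge map when [A] is linear and [s != t]; [f0] is the default value outside
    [edges]. *)
Definition face_at (e : V s * V t) : face V :=
  odflt f0 [pick f : face V in A | (f s, f t) == e].

Lemma face_atP (e : V s * V t) : e \in edges ->
  [/\ face_at e \in A, face_at e s = e.1 & face_at e t = e.2].
Proof.
case/imsetP => f fA ->; rewrite /face_at; case: pickP => [g /andP[gA /eqP[-> ->]] //|].
by move/(_ f); rewrite fA eqxx.
Qed.

Lemma card_edges_faces : linear_hypergraph A -> s != t -> #|edges| = #|A|.
Proof.
move=> linA st; apply: card_in_imset => f g fA gA [].
exact: linear_eq linA st fA gA.
Qed.

End Edges.

(** * Popular cycles and a dense subhypergraph with few unpopular ones *)

Section Popularity.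
Variables (R : realType) (V : 'I_3 -> finType) (n : nat) (A : {set face V}).
Hypotheses (cardV : forall j, #|V j| = n) (linA : linear_hypergraph A).

Local Notation N := (n%:R : R).

Definition unpopular_cycles (theta : R) (G : {set face V}) (c s t : 'I_3) (r : nat) :
    {set face_seq V r} :=
  [set D in cycles G s t r | ~~ popular n theta A c s t D].

Lemma cycles_sub (G G' : {set face V}) (s t : 'I_3) (r : nat) :
  G \subset G' -> cycles G s t r \subset cycles G' s t r.
Proof.
move=> GG'; apply/subsetP => f; rewrite !inE => /andP[/forallP fG ->].
by rewrite andbT; apply/forallP => i; apply: (subsetP GG').
Qed.

Section OneClass.
Variables (c s t : 'I_3).
Hypotheses (cs : c != s) (ct : c != t) (st : s != t).

(* Translating a cycle D from the base e to the base e' gives another cycle with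
   the same labels, and e' can be recovered from e and the translate. *)
Lemma card_bases_le (r : nat) (D : face_seq V r) : (0 < r)%N ->
    D \in cycles A s t r ->
  (#|[set b in base_pairs A c | [forall i, D i \in opposite_faces A c s t b]]| <=
   #|A| * #|[set g in cycles A s t r | labels c g == labels c D]|)%N.
Proof.
move=> r0; rewrite inE => /andP[_ /forallP DC].
have ts : t != s by rewrite eq_sym.
rewrite -cardsX.
pose copy (b : face V * face V) : face_seq V r :=
  [ffun i => odflt (D i) [pick f' in A | translated A c s t b.1 b.2 (D i) f']].
have copyP b : [forall i, D i \in opposite_faces A c s t b] -> forall i,
    copy b i \in A /\ translated A c s t b.1 b.2 (D i) (copy b i).
  move=> /forallP Db i; rewrite ffunE; case: pickP => [f' /andP[] //|no].
  have := Db i; rewrite inE => /andP[_ /exists_inP[f' fA' tr]].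
  by have := no f'; rewrite fA' tr.
apply: (@card_le_inj _ _ _ _ (fun b => (b.1, copy b))) => [b|b b'].
  rewrite !inE => /andP[/and3P[bA _ _] /copyP cP]; rewrite bA /=.
  apply/andP; split; last first.
    apply/eqP/ffunP => i; have [_ /and3P[/eqP Dc _ _]] := cP i.
    by rewrite [LHS]ffunE [RHS]ffunE Dc.
  apply/andP; split; first by apply/forallP => i; have [] := cP i.
  apply/forallP => i; have [_ /and3P[_ l1 l2]] := cP i.
  have [_ /and3P[_ l1' l2']] := cP (ordS i); have := DC i.
  (* A vertex shared by consecutive faces of [D] has one translate only, so the copy is again a
     cycle. *)
  case: ifP => _ /eqP Dt; apply/eqP.
    exact: linked_eq linA cs st _ _ _ _ _ _ l1 l1' Dt.
  exact: linked_eq linA ct ts _ _ _ _ _ _ l2 l2' Dt.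
rewrite !inE => /andP[/and3P[_ bA /eqP bc] /copyP cP].
move=> /andP[/and3P[_ bA' /eqP bc'] /copyP cP'] [b1 b2].
(* A single position of the copy already determines the second base. *)
have i : 'I_(2 * r) by exists 0%N; rewrite muln_gt0.
have [_ /and3P[_ l1 _]] := cP i; have [_ /and3P[_ l1' _]] := cP' i.
case: b b' bA bA' bc bc' b1 b2 l1 l1' {cP cP'} => [e e'] [g g'] /= bA bA' bc bc' eg cE.
rewrite -{}cE; subst g => l1 l1'; congr (_, _).
apply: linear_eq linA cs bA bA' _ _; first by rewrite -bc -bc'.
exact: linked_base_eq linA ct st _ _ _ _ _ l1 l1'.
Qed.

(** Summing over cycles first: an unpopular cycle has fewer than [theta * N] copies, so by
    [card_bases_le] it survives for at most [N ^+ 2 * (theta * N)] base pairs. *)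
Lemma sum_unpopular_le (theta : R) (r : nat) : 0 < theta -> (0 < r)%N ->
  \sum_(b in base_pairs A c)
    #|unpopular_cycles theta (opposite_faces A c s t b) c s t r|%:R
  <= theta * N ^+ 3 * N ^+ (2 * r).
Proof.
move=> th0 r0.
have th_ge0 : 0 <= theta * N ^+ 3 by rewrite mulr_ge0 ?exprn_ge0 ?ler0n // ltW.
apply: (@le_trans _ _ (\sum_(D in cycles A s t r) theta * N ^+ 3)); last first.
  rewrite sumr_const -[leLHS]mulr_natr ler_wpM2l // -natrX ler_nat.
  exact: card_cycles_le.
rewrite (eq_bigr (fun b => \sum_D
    (D \in unpopular_cycles theta (opposite_faces A c s t b) c s t r)%:R)); last first.
  by move=> b _; rewrite card_setR; apply: eq_bigr => D _; rewrite [in RHS]inE.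
rewrite exchange_big /= [leRHS]big_mkcond; apply: ler_sum => D _.
have oppA b : opposite_faces A c s t b \subset A.
  by apply/subsetP => f; rewrite inE => /andP[].
have [DA|DA] := ifPn; last first.
  rewrite big1 // => b _; rewrite [in LHS]inE.
  by rewrite (contraNF (subsetP (cycles_sub s t r (oppA b)) D) DA).
have [pop|unpop] := boolP (popular n theta A c s t D).
  by rewrite big1 // => b _; rewrite [in LHS]inE pop andbF.
apply: (@le_trans _ _ #|[set b in base_pairs A c |
    [forall i, D i \in opposite_faces A c s t b]]|%:R).
  rewrite card_setR big_mkcond /=; apply: ler_sum => b _.
  case: (b \in base_pairs A c) => //=; rewrite [in leLHS]inE unpop andbT.
  by rewrite [in leLHS]inE; case: [forall i, _]; rewrite //= lern1 leq_b1.
apply: (@le_trans _ _ (#|A| * #|[set g in cycles A s t r | labels c g == labels c D]|)%N%:R).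
  by rewrite ler_nat card_bases_le.
rewrite natrM (_ : theta * N ^+ 3 = N ^+ 2 * (theta * N)); last by ring.
apply: ler_pM; rewrite ?ler0n //; first by rewrite -natrX ler_nat (card_faces_le cardV linA st).
by apply: ltW; rewrite ltNge.
Qed.

(** Popularity in [A] confines the labels of the counted cycles to a set [P] of at most N^3 / theta
    sequences; Cauchy-Schwarz over [P] then yields many pairs of cycles of [G] with equal labels. *)
Lemma card_octahedra_dense (theta : R) (G : {set face V}) :
    0 < theta -> (0 < n)%N -> G \subset A ->
  theta * #|[set f in cycles G s t 2 | popular n theta A c s t f]|%:R ^+ 2
    <= N ^+ 3 * #|octahedra G|%:R.
Proof.
move=> th0 n0 GA; have N0 : 0 < N by rewrite ltr0n.
pose L := {ffun 'I_(2 * 2) -> V c}.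
pose m (H : {set face V}) (l : L) := #|[set f in cycles H s t 2 | labels c f == l]|.
pose P := [set l : L | theta * N <= (m A l)%:R].
(* Each sequence in [P] accounts for at least [theta * N] of the at most [N ^+ 4] 4-cycles of
   [A]. *)
have cardP : #|P|%:R * (theta * N) <= N ^+ 4.
  rewrite mulr_natl -sumr_const.
  apply: (@le_trans _ _ (\sum_(l in P) (m A l)%:R)).
    by apply: ler_sum => l; rewrite inE.
  apply: (@le_trans _ _ (#|cycles A s t 2|)%:R).
    rewrite -natr_sum ler_nat -sum1_card (sum_fibers _ (@labels V c 2) (fun=> 1%N)).
    by rewrite big_mkcond /=; apply: leq_sum => l _; case: ifP; rewrite // muln1.
  by rewrite -natrX ler_nat (card_cycles_le cardV linA st).
have -> : #|[set f in cycles G s t 2 | popular n theta A c s t f]|%:R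
    = \sum_(l in P) (m G l)%:R :> R.
  rewrite -natr_sum; congr (_%:R).
  transitivity (\sum_(f in cycles G s t 2) (labels c f \in P))%N.
    rewrite card_set_sum [RHS]big_mkcond; apply: eq_bigr => f _.
    by case: (f \in cycles G s t 2) => //=; rewrite [in RHS]inE.
  rewrite (sum_fibers _ (@labels V c 2) (fun l => (l \in P) : nat)) [RHS]big_mkcond.
  by apply: eq_bigr => l _; case: (l \in P); rewrite ?muln1 ?muln0.
have oct : \sum_(l in P) (m G l)%:R ^+ 2 <= #|octahedra G|%:R :> R.
  have := card_octahedra_ge G cs ct st; rewrite -(ler_nat R); apply: le_trans.
  rewrite (sum_fibers _ (@labels V c 2) (m G)) natr_sum.
  rewrite big_mkcond; apply: ler_sum => l _; rewrite natrM expr2.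
  by case: ifP => // _; rewrite mulr_ge0.
have CS := sqr_sum_le P (fun l => (m G l)%:R : R).
have thN : 0 < theta * N by rewrite mulr_gt0.
rewrite -(ler_pM2r N0) mulrAC.
apply: (@le_trans _ _ (theta * N * (#|P|%:R * #|octahedra G|%:R))).
  by rewrite ler_pM2l //; apply: le_trans CS _; rewrite ler_wpM2l ?ler0n.
have -> : theta * N * (#|P|%:R * #|octahedra G|%:R) =
  #|P|%:R * (theta * N) * #|octahedra G|%:R by ring.
have -> : N ^+ 3 * #|octahedra G|%:R * N = N ^+ 4 * #|octahedra G|%:R by ring.
by rewrite ler_wpM2r ?ler0n.
Qed.

Lemma card_cycles4_ge (G : {set face V}) : (0 < n)%N -> G \subset A ->
  #|G|%:R ^+ 4 <= N ^+ 4 * #|cycles G s t 2|%:R.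
Proof.
move=> n0 GA; have [->|[f0 _]] := set_0Vmem G.
  by rewrite cards0 expr0n mulr_ge0 ?exprn_ge0 ?ler0n.
have linG := linear_subset GA linA.
rewrite -(card_edges_faces linG st).
apply: le_trans (@card_rectangles_ge R _ _ n (edges G s t) (cardV s) (cardV t) n0) _.
rewrite ler_wpM2l ?exprn_ge0 ?ler0n // ler_nat.
pose ph := @face_at V G s t f0.
apply: (@card_le_inj _ _ _ _ (fun z : (V s * V s) * (V t * V t) =>
  rectangle (ph (z.1.1, z.2.1)) (ph (z.1.1, z.2.2))
            (ph (z.1.2, z.2.2)) (ph (z.1.2, z.2.1)))).
  move=> z; rewrite inE => /and4P[].
  move=> /(face_atP f0)[A1 s1 t1] /(face_atP f0)[A2 s2 t2].
  move=> /(face_atP f0)[A3 s3 t3] /(face_atP f0)[A4 s4 t4].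
  by apply: rectangle_cycle; rewrite ?s1 ?s2 ?s3 ?s4 ?t1 ?t2 ?t3 ?t4.
move=> [[x x'] [y y']] [[u u'] [v v']]; rewrite !inE /=.
case/and4P=> /(face_atP f0)[_ /= s1 t1] _ /(face_atP f0)[_ /= s3 t3] _.
case/and4P=> /(face_atP f0)[_ /= s1' t1'] _ /(face_atP f0)[_ /= s3' t3'] _.
(* The opposite corners at positions 0 and 2 carry all four vertices. *)
move=> /ffunP eqz; have := eqz (inord 0); have := eqz (inord 2).
rewrite !ffunE !inordK //= => e3 e1.
have xu : x = u by rewrite -s1' -[X in X = _]s1; apply: (congr1 (fun f : face V => f s) e1).
have xu' : x' = u' by rewrite -s3' -[X in X = _]s3; apply: (congr1 (fun f : face V => f s) e3).
have yv : y = v by rewrite -t1' -[X in X = _]t1; apply: (congr1 (fun f : face V => f t) e1).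
have yv' : y' = v' by rewrite -t3' -[X in X = _]t3; apply: (congr1 (fun f : face V => f t) e3).
by rewrite xu xu' yv yv'.
Qed.

End OneClass.

(** [G] is the set of opposite faces of a base pair chosen by averaging. One choice serves all
    lengths and both patterns, since their normalized unpopular counts are added up in a single
    penalty. *)
Lemma popular_subhypergraph (c s t : 'I_3) (eps theta : R) (k : nat) :
    c != s -> c != t -> s != t -> (0 < n)%N -> (0 < k)%N ->
    0 < eps -> 0 < theta -> eps * N ^+ 5 <= #|octahedra A|%:R ->
  exists G : {set face V}, [/\ G \subset A, eps / 2 * N ^+ 2 <= #|G|%:R &
    forall r, (1 <= r <= k)%N ->
      eps * #|unpopular_cycles theta G c s t r|%:R
        <= 4 * k%:R * theta * N ^+ (2 * r) /\
      eps * #|unpopular_cycles theta G c t s r|%:R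
        <= 4 * k%:R * theta * N ^+ (2 * r)].
Proof.
move=> cs ct st n0 k0 eps0 th0 oct; have N0 : 0 < N by rewrite ltr0n.
have ts : t != s by rewrite eq_sym.
have K0 : 0 < k%:R :> R by rewrite ltr0n.
pose opp b := opposite_faces A c s t b.
pose u b r : R := #|unpopular_cycles theta (opp b) c s t r|%:R +
                  #|unpopular_cycles theta (opp b) c t s r|%:R.
pose X b : R := #|opp b|%:R / N ^+ 2.
pose Y b : R := \sum_(j < k) u b j.+1 / N ^+ (2 * j.+1).
(* The mean of [X] is at least [eps] and that of [Y] at most 2k theta relative to N^3 pairs, so this
   weight spends half of the gain. *)
pose lam := eps / (4 * k%:R * theta).
have lam0 : 0 < lam by rewrite divr_gt0 // !mulr_gt0.
have oppA b : opp b \subset A by apply/subsetP => f; rewrite inE => /andP[].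
have sumX : eps * N ^+ 3 <= \sum_(b in base_pairs A c) X b.
  rewrite -mulr_suml ler_pdivlMr ?exprn_gt0 // -mulrA -exprD -natr_sum.
  by apply: le_trans oct _; rewrite ler_nat card_octahedra_le.
have sumY : \sum_(b in base_pairs A c) Y b <= 2 * k%:R * theta * N ^+ 3.
  rewrite exchange_big /=.
  have -> : 2 * k%:R * theta * N ^+ 3 = \sum_(j < k) 2 * theta * N ^+ 3.
    by rewrite sumr_const card_ord -[RHS]mulr_natr; ring.
  apply: ler_sum => j _; rewrite -mulr_suml ler_pdivrMr ?exprn_gt0 // big_split /=.
  have h1 := sum_unpopular_le cs ct st th0 (ltn0Sn j).
  have h2 := sum_unpopular_le ct cs ts th0 (ltn0Sn j).
  (* The opposite faces do not depend on the order of [s] and [t], so the bound applies to the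
     reversed pattern as well. *)
  rewrite (eq_bigr (fun b =>
     #|unpopular_cycles theta (opp b) c t s j.+1|%:R)) in h2; last first.
    by move=> b _; rewrite -opposite_facesC.
  rewrite (_ : 2 * theta * N ^+ 3 * N ^+ (2 * j.+1) =
    theta * N ^+ 3 * N ^+ (2 * j.+1) + theta * N ^+ 3 * N ^+ (2 * j.+1)); last by ring.
  exact: lerD.
have [||||b bB Fb] := @exists_ge_average R _ (base_pairs A c)
   (fun b => X b - lam * Y b) (eps / 2) (N ^+ 3).
- by rewrite divr_gt0.
- by rewrite exprn_gt0.
- by rewrite -natrX ler_nat (card_base_pairs_le cardV linA cs st).
- rewrite sumrB -mulr_sumr.
  have := ler_wpM2l (ltW lam0) sumY.
  have -> : lam * (2 * k%:R * theta * N ^+ 3) = eps / 2 * N ^+ 3.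
    by rewrite /lam; field; rewrite !gt_eqF.
  set a := \sum_(b in _) _; set a' := \sum_(b in _) _ in sumX *.
  by rewrite /a; move: sumX; lra.
have u_ge0 j : 0 <= u b j by rewrite addr_ge0 ?ler0n.
have Y_ge0 : 0 <= Y b by apply: sumr_ge0 => j _; rewrite divr_ge0 ?exprn_ge0 ?ler0n.
have lamY : 0 <= lam * Y b by rewrite mulr_ge0 // ltW.
exists (opp b); split=> [//||r /andP[r1 rk]].
  by rewrite -ler_pdivlMr ?exprn_gt0 //; move: Fb; rewrite /X; lra.
have X1 : X b <= 1.
  rewrite ler_pdivrMr ?exprn_gt0 // mul1r -natrX ler_nat.
  exact: leq_trans (subset_leq_card (oppA b)) (card_faces_le cardV linA st).
have uY : u b r / N ^+ (2 * r) <= Y b.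
  case: r r1 rk => // r _ rk; rewrite /Y (bigD1 (Ordinal rk)) //= lerDl.
  by apply: sumr_ge0 => j _; rewrite divr_ge0 ?exprn_ge0 ?ler0n.
have eps_u : eps * u b r <= 4 * k%:R * theta * N ^+ (2 * r).
  have lam_u : lam * (u b r / N ^+ (2 * r)) <= 1.
    by have := ler_wpM2l (ltW lam0) uY; lra.
  have -> : eps * u b r =
      4 * k%:R * theta * N ^+ (2 * r) * (lam * (u b r / N ^+ (2 * r))).
    by rewrite /lam; field; rewrite !gt_eqF ?exprn_gt0.
  by rewrite ler_piMr // !mulr_ge0 ?exprn_ge0 ?ler0n // ltW.
by split; apply: le_trans eps_u; rewrite ler_pM2l // ?lerDl ?lerDr.
Qed.

End Popularity.

(** * From prisms to popular ring decompositions *)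

Section RingDecompositions.
Variables (R : realType) (V : 'I_3 -> finType) (n : nat) (A : {set face V}).
Hypotheses (cardV : forall j, #|V j| = n) (n_gt0 : (0 < n)%N).

Local Notation N := (n%:R : R).

(** After exchanging the sides, the edge that advances the second cycle at index [j] is the former
    one at index [ordS j]. *)
Lemma card_prisms_swap (S T : finType) (E : {set S * T}) (E' : {set T * S})
    (r : nat) (x : 'I_r -> S) (y : 'I_r -> T) :
    (forall p q, (p, q) \in E -> (q, p) \in E') ->
  (#|prisms E (@ord_pred r) x y| <= #|prisms E' (@ordS r) y x|)%N.
Proof.
move=> EE'; apply: (@card_le_inj _ _ _ _ (fun z => (z.2, z.1)));
  last by move=> [? ?] [? ?] _ _ [-> ->].
move=> [u v]; rewrite !inE /= => /forallP uvP; apply/forallP => j /=.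
have /and4P[a1 a2 a3 _] := uvP j; have /and4P[_ _ _ a4] := uvP (ordS j).
by rewrite ordSK in a4; rewrite !EE'.
Qed.

Lemma popular_ring_decompositions_sub (theta theta' : R) (B : {set face V})
    (c s t : 'I_3) (r : nat) (f : face_seq V r) :
    theta' <= theta -> B \subset A ->
  popular_ring_decompositions n theta B c s t f \subset
  popular_ring_decompositions n theta' A c s t f.
Proof.
move=> th BA.
have pop s' t' r' (g : face_seq V r') :
    popular n theta B c s' t' g -> popular n theta' A c s' t' g.
  move=> pg; apply: (@le_trans _ _ (theta * N)); first by rewrite ler_wpM2r.
  apply: le_trans pg _; rewrite ler_nat subset_leq_card //.
  apply/subsetP => h; rewrite [h \in _]inE [in X in _ -> X]inE => /andP[hB ->].
  by rewrite (subsetP (cycles_sub _ _ _ BA)).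
apply/subsetP => g; rewrite [g \in _]inE [in X in _ -> X]inE.
case/and3P => gB /pop -> /forallP gP; rewrite (subsetP (cycles_sub _ _ _ BA)) //=.
apply/forallP => i; have /exists_inP[h hB /exists_inP[h' hB' /and5P[p1 p2 p3 p4 /pop p5]]] := gP i.
apply/exists_inP; exists h; first exact: (subsetP BA).
apply/exists_inP; exists h'; first exact: (subsetP BA).
exact/and5P.
Qed.

Definition unpopular_rectangles_at (theta : R) (G : {set face V})
    (c p q : 'I_3) (f : face V) : {set face_seq V 2} :=
  [set D in unpopular_cycles n A theta G c p q 2 | D (inord 0) == f].

(** The second cycle of a prism over [f] is a ring decomposition, and distinct prisms give distinct
    ones. Discarded are the prisms whose second cycle is unpopular and, for each of the [2 * r]
    positions, those whose rectangle is unpopular; a bad rectangle fixes two of the [2 * r]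
    vertices. *)
Lemma ring_decompositions_ge (theta gamma0 beta theta' : R) (G : {set face V})
    (c p q : 'I_3) (r : nat) (f : face_seq V r) :
    G \subset A -> p != q -> f \in cycles G p q r -> (0 < r)%N ->
    gamma0 * N ^+ (2 * r) <= #|prisms (edges G p q) (@ordS r)
        (fun j => f (even_index j) p) (fun j => f (even_index j) q)|%:R ->
    (forall i, #|unpopular_rectangles_at theta G c p q (f i)|%:R <= beta * N ^+ 2) ->
    #|unpopular_cycles n A theta G c q p r|%:R <= theta' * N ^+ (2 * r) ->
  (gamma0 - theta' - (2 * r)%:R * beta) * N ^+ (2 * r)
    <= #|popular_ring_decompositions n theta A c p q f|%:R.
Proof.
move=> GA pq fG r0 prism_ge rect_le unpop_le.
have N0 : 0 < N by rewrite ltr0n.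
have /andP[/forallP fiG fC] : [forall i, f i \in G] && is_cycle p q f by rewrite inE in fG.
have i0 : 'I_(2 * r) by exists 0%N; rewrite muln_gt0.
pose E := edges G p q; pose ph := @face_at V G p q (f i0).
set Q := prisms _ _ _ _ in prism_ge.
(* The edge of the second cycle opposite to [f i]. That cycle has pattern (q, p), so [half_index]
   numbers its class-q vertices. *)
pose e i (z : {ffun 'I_r -> V p} * {ffun 'I_r -> V q}) :=
  (z.1 (next_half_index i), z.2 (half_index i)).
pose Gam (z : {ffun 'I_r -> V p} * {ffun 'I_r -> V q}) : face_seq V r :=
  [ffun i => ph (e i z)].
have QE z i : z \in Q -> [/\ e i z \in E, (f i p, (e i z).2) \in E
    & ((e i z).1, f i q) \in E].
  rewrite inE => /forallP zQ; have [-> ->] := cycle_half_index i fC.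
  have /and4P[a1 _ a3 a4] := zQ (half_index i).
  have /and4P[_ a2 _ _] := zQ (next_half_index i); split=> //.
  by rewrite /e /next_half_index; case: (odd i).
have phP d : d \in E -> [/\ ph d \in G, ph d p = d.1 & ph d q = d.2].
  exact: face_atP.
have GamE z i : z \in Q -> [/\ Gam z i \in G, Gam z i p = z.1 (next_half_index i)
    & Gam z i q = z.2 (half_index i)].
  by move=> zQ; rewrite ffunE; have [/phP] := QE z i zQ.
have Gam_cycle z : z \in Q -> Gam z \in cycles G q p r.
  move=> zQ; rewrite inE; apply/andP; split.
    by apply/forallP => i; have [] := GamE z i zQ.
  by apply: is_cycle_half_index => i; have [_ ? ?] := GamE z i zQ; eassumption.
have Gam_inj : {in Q &, injective Gam}.
  move=> [u v] [u' v'] zQ zQ' Gz; congr (_, _); apply/ffunP => j.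
    have [_ + _] := GamE _ (even_index j) zQ.
    have [_ + _] := GamE _ (even_index j) zQ'.
    by rewrite Gz next_half_index_even => -> /= ->.
  have [_ _ +] := GamE _ (even_index j) zQ.
  have [_ _ +] := GamE _ (even_index j) zQ'.
  by rewrite Gz half_index_even => -> /= ->.
pose rect i (d : V p * V q) :=
  rectangle (f i) (ph (f i p, d.2)) (ph d) (ph (d.1, f i q)).
pose B i := [set d : V p * V q | [&& d \in E, (f i p, d.2) \in E,
   (d.1, f i q) \in E & ~~ popular n theta A c p q (rect i d)]].
have rect_cycle i (d : V p * V q) : d \in E -> (f i p, d.2) \in E ->
    (d.1, f i q) \in E -> rect i d \in cycles G p q 2.
  move=> /phP[d1 d2 d3] /phP[d4 d5 d6] /phP[d7 d8 d9].
  by apply: rectangle_cycle; rewrite ?d2 ?d3 ?d5 ?d6 ?d8 ?d9.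
have cardB i : #|B i|%:R <= beta * N ^+ 2.
  apply: le_trans (rect_le i); rewrite ler_nat.
  apply: (@card_le_inj _ _ _ _ (rect i)) => [d|d d'].
    rewrite inE => /and4P[d1 d2 d3 d4]; rewrite inE; apply/andP; split.
      by rewrite inE rect_cycle.
    by rewrite ffunE inordK.
  rewrite !inE => /and4P[/phP[_ d2 d3] _ _ _] /and4P[/phP[_ d2' d3'] _ _ _].
  move=> /ffunP/(_ (inord 2)); rewrite !ffunE !inordK //= => dd.
  by rewrite (surjective_pairing d) (surjective_pairing d') -d2 -d3 dd d2' d3'.
pose Z1 := [set z in Q | Gam z \in unpopular_cycles n A theta G c q p r].
pose Z2 i := [set z : {ffun 'I_r -> V p} * {ffun 'I_r -> V q} | e i z \in B i].
have cardZ1 : #|Z1|%:R <= theta' * N ^+ (2 * r).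
  apply: le_trans unpop_le; rewrite ler_nat; apply: (@card_le_inj _ _ _ _ Gam).
    by move=> z; rewrite inE => /andP[].
  move=> z z'; rewrite inE => /andP[zQ _]; rewrite inE => /andP[zQ' _].
  exact: Gam_inj.
have cardZ2 i : #|Z2 i|%:R <= beta * N ^+ (2 * r).
  have := card_ffun_pair_coord (next_half_index i) (half_index i) (B i).
  rewrite -/(Z2 i) card_ord !cardV -(ler_nat R) !natrM !natrX -expr2 -exprD addnn -mul2n.
  move=> ZB; rewrite -(ler_pM2r (exprn_gt0 2 N0)); apply: le_trans ZB _.
  by rewrite mulrAC ler_wpM2r ?exprn_ge0 ?ler0n.
have cover : (#|Q| <= #|popular_ring_decompositions n theta A c p q f| +
    (#|Z1| + \sum_i #|Z2 i|))%N.
  rewrite -(cardsID (Z1 :|: \bigcup_i Z2 i) Q) addnC; apply: leq_add; last first.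
    apply: leq_trans (subset_leq_card (subsetIr _ _)) _.
    apply: leq_trans (leq_card_setU _ _).1 _; rewrite leq_add2l.
    elim/big_rec2: _ => [|j m X _ Xm]; first by rewrite cards0.
    by rewrite (leq_trans (leq_card_setU _ _).1) // leq_add2l.
  apply: (@card_le_inj _ _ _ _ Gam); last first.
    by move=> z z'; rewrite !in_setD => /andP[_ zQ] /andP[_ zQ']; apply: Gam_inj.
  move=> z; rewrite in_setD in_setU negb_or => /andP[/andP[zZ1 zZ2] zQ].
  rewrite inE (subsetP (cycles_sub _ _ _ GA)) ?Gam_cycle //=.
  apply/andP; split.
    by move: zZ1; rewrite inE zQ /= inE Gam_cycle //= negbK.
  apply/forallP => i; have [e1 e2 e3] := QE z i zQ.
  have [h1 h2 h3] := phP _ e2; have [k1 k2 k3] := phP _ e3.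
  have [g1 g2 g3] := GamE z i zQ.
  apply/exists_inP; exists (ph ((e i z).1, f i q)); first exact: (subsetP GA).
  apply/exists_inP; exists (ph (f i p, (e i z).2)); first exact: (subsetP GA).
  rewrite g2 g3 h2 h3 k2 k3 /= !eqxx /=.
  have zi : z \notin Z2 i by apply: contra zZ2 => zi; apply/bigcupP; exists i.
  have -> : rectangle (f i) (ph (f i p, (e i z).2)) (Gam z i) (ph ((e i z).1, f i q))
    = rect i (e i z) by rewrite ffunE.
  by move: zi; rewrite inE inE e1 e2 e3 /= negbK.
have sumZ2 : \sum_i #|Z2 i|%:R <= (2 * r)%:R * beta * N ^+ (2 * r).
  have -> : (2 * r)%:R * beta * N ^+ (2 * r) = \sum_(i < 2 * r) beta * N ^+ (2 * r).
    by rewrite sumr_const card_ord -[RHS]mulr_natr; ring.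
  by apply: ler_sum => i _; apply: cardZ2.
move: cover; rewrite -(ler_nat R) !natrD natr_sum; lra.
Qed.

End RingDecompositions.

(** * The step for one label class, then for all three *)

Lemma class_exponents (k : nat) : (100 <= k)%N ->
  [/\ (12 * k ^ 2 + 1 + 4 * k <= 13 * k ^ 2)%N, (13 * k ^ 2 + 58 <= k ^ 5)%N,
      (10 * k ^ 2 + 1 + 2 * k <= 11 * k ^ 2)%N, (10 * k ^ 2 + 1 <= 12 * k ^ 2)%N
    & (11 * k ^ 2 + 8 <= 12 * k ^ 2)%N].
Proof.
move=> k100; have k2 : (100 * k <= k ^ 2)%N by rewrite -mulnn leq_mul2r k100 orbT.
have k5 : (14 * k ^ 2 <= k ^ 5)%N.
  rewrite (expnD k 3 2) leq_mul2r; apply/orP; right.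
  apply: (@leq_trans k); first by apply: leq_trans k100.
  by rewrite -{1}(expn1 k) leq_pexp2l //; apply: leq_trans k100.
by move: (k ^ 2)%N (k ^ 5)%N k2 k5 => a b k2 k5; split; lia.
Qed.

Section OneStep.
Variables (R : realType) (V : 'I_3 -> finType) (n k : nat).
Hypotheses (cardV : forall j, #|V j| = n) (n_gt0 : (0 < n)%N) (k_ge : (100 <= k)%N).

Local Notation N := (n%:R : R).

Let N_gt0 : 0 < N. Proof. by rewrite ltr0n. Qed.

(** Markov's inequality, each unpopular 4-cycle being charged to its face at position 0. *)
Lemma card_heavy_faces_le (A G : {set face V}) (theta beta : R) (c p q : 'I_3) :
  beta * N ^+ 2 * #|[set f | beta * N ^+ 2 <
      #|unpopular_rectangles_at n A theta G c p q f|%:R]|%:R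
    <= #|unpopular_cycles n A theta G c p q 2|%:R.
Proof.
rewrite mulr_natr -sumr_const.
apply: (@le_trans _ _ (\sum_(f in [set f | beta * N ^+ 2 <
      #|unpopular_rectangles_at n A theta G c p q f|%:R])
      #|unpopular_rectangles_at n A theta G c p q f|%:R)).
  by apply: ler_sum => f; rewrite inE => /ltW.
rewrite -natr_sum ler_nat -sum1_card.
rewrite (sum_fibers _ (fun D : face_seq V 2 => D (inord 0)) (fun=> 1%N)).
by rewrite big_mkcond; apply: leq_sum => f _; case: ifP; rewrite // muln1.
Qed.

(** Each of the at most n^3 base pairs has at most [#|A|] opposite faces. *)
Lemma card_faces_octahedra (A : {set face V}) (eps : R) :
    linear_hypergraph A -> eps * N ^+ 5 <= #|octahedra A|%:R ->
  eps * N ^+ 2 <= #|A|%:R.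
Proof.
move=> linA oct; rewrite -(ler_pM2r (exprn_gt0 3 N_gt0)) -mulrA -exprD.
apply: le_trans oct _; rewrite -natrX -natrM ler_nat.
pose s : 'I_3 := inord 0; pose t : 'I_3 := inord 1; pose c : 'I_3 := inord 2.
have [cs ct st] : [/\ c != s, c != t & s != t].
  by rewrite -!val_eqE /= !inordK.
apply: leq_trans (card_octahedra_le cs ct st linA) _.
apply: (@leq_trans (\sum_(b in base_pairs A c) #|A|)%N).
  apply: leq_sum => b _; apply: subset_leq_card.
  by apply/subsetP => f; rewrite inE => /andP[].
by rewrite sum_nat_const mulnC leq_mul2l (card_base_pairs_le cardV linA cs st) orbT.
Qed.

Lemma one_class_step (A : {set face V}) (c s t : 'I_3) (eps : R) :
    c != s -> c != t -> s != t -> linear_hypergraph A ->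
    0 < eps -> eps <= 10 ^- 3 -> eps * N ^+ 5 <= #|octahedra A|%:R ->
  exists A' : {set face V}, [/\ A' \subset A,
      eps ^+ (k ^ 5) * N ^+ 5 <= #|octahedra A'|%:R
    & forall (r : nat) (p q : 'I_3) (f : face_seq V r), (2 <= r <= k)%N ->
        c != p -> c != q -> p != q -> f \in cycles A' p q r ->
        eps ^+ (k ^ 5) * N ^+ (2 * r) <=
          #|popular_ring_decompositions n (eps ^+ (k ^ 5)) A c p q f|%:R].
Proof.
move=> cs ct st linA eps0 eps1 oct; have eps_ge0 := ltW eps0.
have ts : t != s by rewrite eq_sym.
have pow m a b j := @natr_mul_expr_le R eps m a b j eps_ge0 eps1.
have eps_le1 : eps <= 1 by have := @pow 1%N 0%N 1%N 1%N isT isT; rewrite mul1r.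
have mono a b : (a <= b)%N -> eps ^+ b <= eps ^+ a by move=> ab; apply: ler_wiXn2l.
have [ex1 ex2 ex3 ex4 ex5] := class_exponents k_ge.
have k0 : (0 < k)%N by apply: leq_trans k_ge.
(* Prisms have density eps^(10k^2). Multiples of k^2 separate the scales: [beta] must absorb [2 * r]
   below that density, [theta'] must be at most [beta * eps ^+ 8], and [theta] must absorb [4 * k]
   and the division by [eps]. *)
pose theta := eps ^+ (13 * k ^ 2); pose theta' := eps ^+ (12 * k ^ 2).
pose beta := eps ^+ (11 * k ^ 2).
have th0 : 0 < theta by rewrite exprn_gt0.
have [G [GA cardG unpop]] :=
  popular_subhypergraph cardV linA cs ct st n_gt0 k0 eps0 th0 oct.
have th'E : 4 * k%:R * theta <= eps * theta'.
  rewrite -natrM -exprS; apply: (@pow _ _ _ (4 * k)%N); first by rewrite ltnW // ltn_expl.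
  by rewrite -addn1.
have unpop_le r p q : (1 <= r <= k)%N -> c != p -> c != q -> p != q ->
    #|unpopular_cycles n A theta G c p q r|%:R <= theta' * N ^+ (2 * r).
  move=> rk cp cq pq; have [u1 u2] := unpop r rk.
  have le_th' (u : R) : eps * u <= 4 * k%:R * theta * N ^+ (2 * r) ->
      u <= theta' * N ^+ (2 * r).
    move=> eu; rewrite -(ler_pM2l eps0) mulrA; apply: le_trans eu _.
    by rewrite ler_wpM2r ?exprn_ge0 ?ler0n.
  have /or3P[] := class_cases cs ct st p => /eqP pE; subst p; first by rewrite eqxx in cp.
    have /or3P[] := class_cases cs ct st q => /eqP qE; subst q; last exact: le_th'.
      by rewrite eqxx in cq.
    by rewrite eqxx in pq.
  have /or3P[] := class_cases cs ct st q => /eqP qE; subst q; last by rewrite eqxx in pq.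
    by rewrite eqxx in cq.
  exact: le_th'.
have linG := linear_subset GA linA.
(* The density eps/2 of [G] is at least eps^2. *)
pose d := eps ^+ 2.
have d0 : 0 < d by rewrite exprn_gt0.
have d1 : d <= 10 ^- 3 by apply: le_trans eps1; rewrite -[leRHS]expr1 mono.
have dG : d * N ^+ 2 <= #|edges G s t|%:R.
  rewrite (card_edges_faces linG st); apply: le_trans cardG.
  rewrite ler_wpM2r ?exprn_ge0 ?ler0n //.
  by have := @pow 2%N 1%N 2%N 1%N isT isT; rewrite expr1 /d; lra.
have [E' [E'G cardE' prismE]] := prism_subgraph (cardV s) (cardV t) n_gt0 d0 d1 k_ge dG.
pose heavy p q := [set f | beta * N ^+ 2 <
  #|unpopular_rectangles_at n A theta G c p q f|%:R].
pose F := [set f in G | (f s, f t) \in E'].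
(* Faces heavy for either pattern are deleted, since cycles of both patterns must be decomposed. *)
pose A' := F :\: (heavy s t :|: heavy t s).
have A'F : A' \subset F by apply: subsetDl.
have FG : F \subset G by apply/subsetP => f; rewrite inE => /andP[].
have A'A : A' \subset A by apply: subset_trans A'F (subset_trans FG GA).
have beta0 : 0 < beta by rewrite exprn_gt0.
have heavy_le p q : c != p -> c != q -> p != q -> #|heavy p q|%:R <= eps ^+ 8 * N ^+ 2.
  move=> cp cq pq; have bN : 0 < beta * N ^+ 2 by rewrite mulr_gt0 ?exprn_gt0.
  rewrite -(ler_pM2l bN); apply: le_trans (card_heavy_faces_le _ _ _ _ _ _ _) _.
  apply: le_trans (unpop_le 2%N p q _ cp cq pq) _; first by apply: leq_trans k_ge.
  have -> : beta * N ^+ 2 * (eps ^+ 8 * N ^+ 2) = beta * eps ^+ 8 * N ^+ (2 * 2) by ring.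
  by rewrite ler_wpM2r ?exprn_ge0 ?ler0n // -exprD mono.
(* [E'] has density d^3 = eps^6, and each of the two heavy sets has density at most eps^8. *)
have cardA' : eps ^+ 7 * N ^+ 2 <= #|A'|%:R.
  have E'F : (#|E'| <= #|F|)%N.
    apply: leq_trans (leq_imset_card (fun f : face V => (f s, f t)) (mem F)).
    apply: subset_leq_card; apply/subsetP => e eE'.
    have /imsetP[f fG eE] := subsetP E'G e eE'.
    by apply/imsetP; exists f; rewrite // inE fG -eE.
  have FA' : (#|F| <= #|heavy s t| + #|heavy t s| + #|A'|)%N.
    rewrite -(cardsID (heavy s t :|: heavy t s) F) leq_add2r.
    apply: leq_trans (subset_leq_card (subsetIr _ _)) _.
    exact: (leq_card_setU _ _).1.
  have := leq_trans E'F FA'; rewrite -(ler_nat R) !natrD => E'A'.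
  have h1 := heavy_le _ _ cs ct st; have h2 := heavy_le _ _ ct cs ts.
  have e7 : eps ^+ 7 + 2 * eps ^+ 8 <= d ^+ 3.
    rewrite /d -exprM; have := @pow 2%N 6%N 7%N 1%N isT isT.
    by have := @pow 2%N 7%N 8%N 1%N isT isT; have := @pow 4%N 6%N 7%N 1%N isT isT; lra.
  have := ler_wpM2r (exprn_ge0 2 (ltW N_gt0)) e7; rewrite mulrDl; lra.
exists A'; split=> //.
  (* 28 is 4 times the density exponent 7; discarding the unpopular 4-cycles below costs one more
     power. *)
  have C4 : eps ^+ 28 * N ^+ 4 <= #|cycles A' s t 2|%:R.
    rewrite -(ler_pM2l (exprn_gt0 4 N_gt0)).
    apply: le_trans (card_cycles4_ge R cardV linA st n_gt0 A'A).
    have -> : N ^+ 4 * (eps ^+ 28 * N ^+ 4) = (eps ^+ 7 * N ^+ 2) ^+ 4 by ring.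
    by rewrite lerXn2r ?nnegrE ?ler0n // mulr_ge0 ?exprn_ge0 ?ler0n.
  have M_ge : eps ^+ 29 * N ^+ 4 <=
      #|[set f in cycles A' s t 2 | popular n theta A c s t f]|%:R.
    have split_pop : (#|cycles A' s t 2| <=
        #|[set f in cycles A' s t 2 | popular n theta A c s t f]| +
        #|unpopular_cycles n A theta G c s t 2|)%N.
      apply: leq_trans (leq_card_setU _ _).1; apply: subset_leq_card.
      apply/subsetP => f fA'; rewrite in_setU [X in X || _]inE [X in _ || X]inE fA' /=.
      rewrite (subsetP (cycles_sub s t 2 (subset_trans A'F FG)) f fA') /=.
      exact: orbN.
    have u2 : #|unpopular_cycles n A theta G c s t 2|%:R <= theta' * N ^+ (2 * 2).
      by apply: unpop_le => //; apply: leq_trans k_ge.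
    have e29 : eps ^+ 29 + theta' <= eps ^+ 28.
      have := @pow 2%N 28%N 29%N 1%N isT isT.
      suff : theta' <= eps ^+ 29 by lra.
      apply: mono; apply: (@leq_trans (12 * 100)%N) => //.
      by rewrite leq_mul2l /= (leq_trans k_ge) // -{1}(expn1 k) leq_pexp2l.
    have := ler_wpM2r (exprn_ge0 4 (ltW N_gt0)) e29; rewrite mulrDl.
    move: split_pop; rewrite -(ler_nat R) natrD; lra.
  rewrite -(ler_pM2l (exprn_gt0 3 N_gt0)).
  apply: le_trans (card_octahedra_dense cardV linA cs ct st th0 n_gt0 A'A).
  apply: (@le_trans _ _ (theta * (eps ^+ 29 * N ^+ 4) ^+ 2)).
    have -> : theta * (eps ^+ 29 * N ^+ 4) ^+ 2 = N ^+ 3 * (theta * eps ^+ 58 * N ^+ 5).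
      by ring.
    by rewrite ler_pM2l ?exprn_gt0 // ler_wpM2r ?exprn_ge0 ?ler0n // -exprD mono.
  rewrite ler_pM2l // lerXn2r ?nnegrE ?ler0n //.
  by rewrite mulr_ge0 ?exprn_ge0 ?ler0n.
move=> r p q f /andP[r2 rk] cp cq pq fA'.
have r0 : (0 < r)%N by apply: leq_trans r2.
have fE' j : (f (even_index j) s, f (even_index j) t) \in E'.
  have := fA'; rewrite inE => /andP[/forallP/(_ (even_index j)) /(subsetP A'F)].
  by rewrite inE => /andP[].
have light i p' q' : f i \notin heavy p' q' ->
    #|unpopular_rectangles_at n A theta G c p' q' (f i)|%:R <= beta * N ^+ 2.
  by rewrite inE -leNgt.
have fi i : f i \notin heavy s t :|: heavy t s.
  by have := fA'; rewrite inE => /andP[/forallP/(_ i)]; rewrite inE => /andP[].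
have prism_pq : eps ^+ (10 * k ^ 2) * N ^+ (2 * r) <=
    #|prisms (edges G p q) (@ordS r)
        (fun j => f (even_index j) p) (fun j => f (even_index j) q)|%:R /\
    forall i, f i \notin heavy p q.
  have dE : eps ^+ (10 * k ^ 2) = d ^+ (5 * k ^ 2) by rewrite -exprM mulnA.
  have rk2 : (2 <= r <= k)%N by rewrite r2.
  have /or3P[] := class_cases cs ct st p => /eqP pE; subst p; first by rewrite eqxx in cp.
    have /or3P[] := class_cases cs ct st q => /eqP qE; subst q;
      [by rewrite eqxx in cq | by rewrite eqxx in pq | split; last first].
      by move=> i; have := fi i; rewrite in_setU negb_or => /andP[].
    rewrite dE; apply: (prismE r _ (@ord_pred r)) => // [|j]; first exact: ordSK.
    exact: ord_pred_neq.
  have /or3P[] := class_cases cs ct st q => /eqP qE; subst q;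
    [by rewrite eqxx in cq | split; last first | by rewrite eqxx in pq].
    by move=> i; have := fi i; rewrite in_setU negb_or => /andP[].
  (* For the pattern (t, s) the prisms are found with [ord_pred] in the graph on classes s, t and
     then transposed. *)
  apply: (@le_trans _ _ #|prisms (edges G s t) (@ord_pred r)
        (fun j => f (even_index j) s) (fun j => f (even_index j) t)|%:R).
    rewrite dE; apply: (prismE r _ (@ordS r)) => // [|j]; first exact: ord_predK.
    exact: ordS_neq.
  rewrite ler_nat; apply: card_prisms_swap => x y /imsetP[g gG [-> ->]].
  by apply/imsetP; exists g.
have [prism_ge f_light] := prism_pq.
have th_le : eps ^+ (k ^ 5) <= theta by apply: mono; apply: leq_trans ex2; apply: leq_addr.
apply: (@le_trans _ _ #|popular_ring_decompositions n theta A c p q f|%:R); last first.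
  by rewrite ler_nat subset_leq_card // popular_ring_decompositions_sub.
apply: le_trans (ring_decompositions_ge cardV n_gt0 GA pq _ r0 prism_ge
  (fun i => light i p q (f_light i)) (unpop_le r q p _ cq cp _)).
- rewrite ler_wpM2r ?exprn_ge0 ?ler0n //.
  have b1 : (2 * r)%:R * beta <= eps ^+ (10 * k ^ 2 + 1).
    apply: (@pow _ _ _ (2 * k)%N) => //.
    by apply: (@leq_trans (2 * k)%N); [rewrite leq_mul2l | rewrite ltnW // ltn_expl].
  have b2 : theta' <= eps ^+ (10 * k ^ 2 + 1) by apply: mono.
  have b3 := @pow 4%N (10 * k ^ 2)%N (10 * k ^ 2 + 1)%N 1%N isT (leqnn _).
  have b4 : eps ^+ (k ^ 5) <= eps ^+ (10 * k ^ 2 + 1).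
    apply: mono; apply: leq_trans ex2; apply: leq_add => //.
    by rewrite leq_mul2r orbT.
  have b5 : 0 <= eps ^+ (10 * k ^ 2 + 1) by rewrite exprn_ge0.
  by move: b1 b2 b3 b4 b5; rewrite -/theta'; lra.
- exact: (subsetP (cycles_sub _ _ _ (subset_trans A'F FG))).
- by rewrite r0.
- by rewrite eq_sym.
Qed.

End OneStep.

(** The classes are treated in turn, with exponents k^5, k^10, k^15. Earlier conclusions persist:
    cycles of [A3] are cycles of the larger [A1] and [A2], and decompositions found in [A1] or [A2]
    are decompositions in [A]. *)
Lemma all_classes_step (R : realType) (V : 'I_3 -> finType) (n k : nat)
    (A : {set face V}) (eps : R) :
    (forall j, #|V j| = n) -> (0 < n)%N -> (100 <= k)%N -> linear_hypergraph A ->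
    0 < eps -> eps <= 10 ^- 3 -> eps * n%:R ^+ 5 <= #|octahedra A|%:R ->
  exists A' : {set face V}, [/\ A' \subset A,
      eps ^+ (k ^ 15) * n%:R ^+ 5 <= #|octahedra A'|%:R
    & forall (r : nat) (c s t : 'I_3) (f : face_seq V r), (2 <= r <= k)%N ->
        c != s -> c != t -> s != t -> f \in cycles A' s t r ->
        eps ^+ (k ^ 15) * n%:R ^+ (2 * r) <=
          #|popular_ring_decompositions n (eps ^+ (k ^ 15)) A c s t f|%:R].
Proof.
move=> cardV n0 k100 linA eps0 eps1 oct.
have k0 : (0 < k)%N by apply: leq_trans k100.
have eps_le1 : eps <= 1.
  by apply: le_trans eps1 _; rewrite invf_le1 ?exprn_gt0 ?exprn_ege1 ?ler1n ?ltr0n.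
pose c0 : 'I_3 := inord 0; pose c1 : 'I_3 := inord 1; pose c2 : 'I_3 := inord 2.
have [c01 c02 c12] : [/\ c0 != c1, c0 != c2 & c1 != c2].
  by rewrite -!val_eqE /= !inordK.
have [c10 c20 c21] : [/\ c1 != c0, c2 != c0 & c2 != c1] by rewrite ![_ == c0]eq_sym [c2 == _]eq_sym.
have small (m : nat) : (0 < m)%N -> eps ^+ m <= 10 ^- 3.
  by move=> m0; apply: le_trans eps1; rewrite -[leRHS]expr1 ler_wiXn2l // ltW.
have epsM (a b : nat) : (eps ^+ (k ^ a)) ^+ (k ^ b) = eps ^+ (k ^ (a + b)).
  by rewrite -exprM -expnD.
have [A1 [A1A oct1 ring1]] :=
  one_class_step cardV n0 k100 c01 c02 c12 linA eps0 eps1 oct.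
have k5 : (0 < k ^ 5)%N by rewrite expn_gt0 k0.
have [A2 [A2A1 oct2 ring2]] := one_class_step cardV n0 k100 c10 c12 c02
  (linear_subset A1A linA) (exprn_gt0 _ eps0) (small _ k5) oct1.
rewrite epsM in oct2 ring2.
have k10 : (0 < k ^ (5 + 5))%N by rewrite expn_gt0 k0.
have [A3 [A3A2 oct3 ring3]] := one_class_step cardV n0 k100 c20 c21 c01
  (linear_subset (subset_trans A2A1 A1A) linA) (exprn_gt0 _ eps0) (small _ k10) oct2.
rewrite epsM in oct3 ring3.
have A2A := subset_trans A2A1 A1A.
exists A3; split=> [||r c s t f rk cs ct st fA3]; first exact: subset_trans A3A2 A2A.
  exact: oct3.
have weaken (B : {set face V}) (m : nat) : (m <= 15)%N -> B \subset A ->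
    eps ^+ (k ^ m) * n%:R ^+ (2 * r) <=
      #|popular_ring_decompositions n (eps ^+ (k ^ m)) B c s t f|%:R ->
    eps ^+ (k ^ 15) * n%:R ^+ (2 * r) <=
      #|popular_ring_decompositions n (eps ^+ (k ^ 15)) A c s t f|%:R.
  move=> m15 BA rB.
  have le15 : eps ^+ (k ^ 15) <= eps ^+ (k ^ m).
    by rewrite ler_wiXn2l ?leq_pexp2l // ltW.
  apply: (@le_trans _ _ (eps ^+ (k ^ m) * n%:R ^+ (2 * r))).
    by rewrite ler_wpM2r ?exprn_ge0 ?ler0n.
  apply: le_trans rB _; rewrite ler_nat subset_leq_card //.
  exact: popular_ring_decompositions_sub.
have fA2 := subsetP (cycles_sub s t r A3A2) f fA3.
have fA1 := subsetP (cycles_sub s t r A2A1) f fA2.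
have /or3P[] := class_cases c01 c02 c12 c => /eqP cE; subst c.
- by apply: (weaken A 5%N) => //; apply: ring1.
- by apply: (weaken A1 (5 + 5)%N) => //; apply: ring2.
- by apply: (weaken A2 (5 + 5 + 5)%N) => //; apply: ring3.
Qed.

(** * Iteration of the step *)

Theorem theorem3p3 (R : realType) (eps : R) (k : nat)
    (eps_gt0 : 0 < eps) (eps_le : eps <= 10 ^- 3) (k_ge : (100 <= k)%N) :
  exists alpha_ eps_ theta_ gamma_ : nat -> R,
    (forall i : nat, (1 <= i)%N ->
       [/\ eps ^+ (k ^ (15 * i)) <= alpha_ i,
           eps ^+ (k ^ (15 * i)) <= eps_ i,
           eps ^+ (k ^ (15 * i)) <= theta_ i
         & eps ^+ (k ^ (15 * i)) <= gamma_ i]) /\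
    forall (n : nat) (V : 'I_3 -> finType) (A : {set face V}),
      (forall j : 'I_3, #|V j| = n) ->
      linear_hypergraph A ->
      eps * n%:R ^+ 5 <= #|octahedra A|%:R ->
      exists A_ : nat -> {set face V},
        [/\ A_ 0%N = A,
            forall i : nat, A_ i.+1 \subset A_ i
          & forall i : nat, (1 <= i)%N ->
              [/\ alpha_ i * n%:R ^+ 2 <= #|A_ i|%:R,
                  eps_ i * n%:R ^+ 5 <= #|octahedra (A_ i)|%:R
                & forall (r : nat) (c s t : 'I_3) (f : face_seq V r),
                    (2 <= r <= k)%N ->
                    c != s -> c != t -> s != t ->
                    f \in cycles (A_ i) s t r ->
                    gamma_ i * n%:R ^+ (2 * r) <=
                      #|popular_ring_decompositions n (theta_ i) (A_ i.-1)
                          c s t f|%:R]].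
Proof.
(* One sequence serves for all four parameters; [e 0] is [eps], so the hypothesis on [A] starts the
   induction. *)
pose e i := eps ^+ (k ^ (15 * i)).
exists e, e, e, e; split=> [i _|n V A cardV linA oct]; first by split.
(* For n = 0 all lower bounds are 0, as the exponents of [n] are positive, and the constant sequence
   works. *)
have [n0|n_gt0] := posnP n.
  exists (fun=> A); split=> // i _; rewrite n0.
  by split=> [||r c s t f /andP[r2 _] _ _ _ _];
    rewrite expr0n ?muln_eq0 ?(gtn_eqF (leq_trans _ r2)) //= mulr0 ler0n.
have k_gt0 : (0 < k)%N by apply: leq_trans k_ge.
have eps_le1 : eps <= 1.
  by apply: le_trans eps_le _; rewrite invf_le1 ?exprn_gt0 ?exprn_ege1 ?ler1n ?ltr0n.
have e_gt0 i : 0 < e i by rewrite exprn_gt0.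
have e_le i : e i <= 10 ^- 3.
  apply: le_trans eps_le; rewrite -[leRHS]expr1 ler_wiXn2l // ?ltW //.
  by rewrite expn_gt0 k_gt0.
have eS i : e i ^+ (k ^ 15) = e i.+1 by rewrite -exprM -expnD /e mulnS addnC.
pose inv i (B : {set face V}) := linear_hypergraph B /\ e i * n%:R ^+ 5 <= #|octahedra B|%:R.
pose good i (B B' : {set face V}) := forall (r : nat) (c s t : 'I_3) (f : face_seq V r),
  (2 <= r <= k)%N -> c != s -> c != t -> s != t -> f \in cycles B' s t r ->
  e i.+1 * n%:R ^+ (2 * r) <= #|popular_ring_decompositions n (e i.+1) B c s t f|%:R.
(* The step is stated for every pair, trivially where the invariant fails, so that [choice] yields a
   total function to iterate. *)
have step (x : nat * {set face V}) : exists B' : {set face V}, inv x.1 x.2 ->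
    [/\ B' \subset x.2, inv x.1.+1 B' & good x.1 x.2 B'].
  case: x => i B /=; have [[linB octB]|not_inv] := pselect (inv i B); last by exists B.
  have [B' [B'B octB' ringB']] :=
    all_classes_step cardV n_gt0 k_ge linB (e_gt0 i) (e_le i) octB.
  rewrite eS in octB' ringB'; exists B' => _; split=> //.
  by split=> //; apply: linear_subset B'B linB.
have [next nextP] := choice step.
pose A_ := nat_rect (fun=> {set face V}) A (fun i B => next (i, B)).
have A_inv i : inv i (A_ i).
  elim: i => [|i IHi]; first by split; rewrite // /e muln0 expn0 expr1.
  by have [] := nextP (i, A_ i) IHi.
exists A_; split=> // [i|[//|i] _]; first by have [] := nextP (i, A_ i) (A_inv i).
have [linAi octAi] := A_inv i.+1; split=> //.
  exact: (card_faces_octahedra cardV n_gt0 linAi octAi).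
by have [_ _] := nextP (i, A_ i) (A_inv i).
Qed.
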